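(* Let $m,k\ge 1$ be integers and let $S_1,S_2,\dots$ be IID random elements of $\mathbb{S}_m$ with common law $P_S$. Assume that $\mathbb{E}_{P_S}\|\mathcal{V}(S)\|^2<\infty$, and that for each $j\in\{1,\dots,k\}$ there exists a unique set $A^j\subset\mathbb{R}^{m(m+1)/2}$ with at most $j$ elements such that $\mathcal{Q}(A^j,P_S)=m_j(P_S)$. For each $n$ let $X_n^k$ be a minimiser of $\mathcal{D}_n^k$. Then, almost surely as $n\to\infty$, $X_n^k\to A^k$ (in the Hausdorff distance between finite subsets of $\mathbb{R}^{m(m+1)/2}$) and $\mathcal{D}_n^k(X_n^k)\to m_k(P_S)$.
   Context: $\mathbb{S}_m$ is the set of $m\times m$ real symmetric positive definite matrices. Each $S\in\mathbb{S}_m$ has a unique Cholesky factor $\mathscr{L}S$: the lower triangular matrix $L$ with positive diagonal such that $S=LL^T$. The map $\mathcal{V}:\mathbb{S}_m\to\mathbb{R}^{m(m+1)/2}$ is $\mathcal{V}(S)=(\ell_1,\dots,\ell_{m(m-1)/2},d_1,\dots,d_m)^T$, where $\ell_1,\dots,\ell_{m(m-1)/2}$ are the strictly lower triangular entries of $\mathscr{L}S$ listed in a fixed order and $d_i=\log\big((\mathscr{L}S)_{ii}\big)$. $\|\cdot\|$ is the Euclidean norm. For $X^k=\{X_1,\dots,X_k\}$ with $X_j\in\mathbb{R}^{m(m+1)/2}$ (not necessarily distinct), the $k$-means objective is $\mathcal{D}_n^k(X^k)=\frac1n\sum_{i=1}^n\min_{1\le j\le k}\|\mathcal{V}(S_i)-X_j\|^2$.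 For a probability measure $P$ on $\mathbb{S}_m$ and a finite nonempty set $A\subset\mathbb{R}^{m(m+1)/2}$, $\mathcal{Q}(A,P)=\mathbb{E}_{S\sim P}\big[\min_{\alpha\in A}\|\mathcal{V}(S)-\alpha\|^2\big]$ and $m_j(P)=\inf\{\mathcal{Q}(A,P): 1\le \#A\le j\}$. *)

(* Defs.v *)
From HB Require Import structures.
From mathcomp Require Import all_boot all_order all_algebra finmap.
From mathcomp Require Import all_classical all_reals all_analysis.
From mathcomp Require Import ring.
Set Implicit Arguments.
Unset Strict Implicit.
Unset Printing Implicit Defensive.
Import Order.TTheory GRing.Theory Num.Theory.
Import numFieldNormedType.Exports.
Local Open Scope classical_set_scope.
Local Open Scope ring_scope.

Definition is_spd (R : realType) (m : nat) : set 'M[R]_m :=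
  [set S | S^T = S /\ forall x : 'cV[R]_m, x != 0 -> 0 < (x^T *m S *m x) 0 0].
Arguments is_spd R m : clear implicits.

Lemma spd1 (R : realType) (m : nat) : is_spd R m 1%:M.
Proof.
split=> [|x x0]; first exact: trmx1.
rewrite mulmx1 mxE.
have ge0 (i : 'I_m) : true -> 0 <= x^T 0 i * x i 0.
  by rewrite mxE -expr2 sqr_ge0.
rewrite lt_neqAle sumr_ge0 // andbT eq_sym; apply: contra x0 => /eqP s0.
apply/eqP/colP => i; have := psumr_eq0P ge0 s0 isT.
by rewrite mxE => /(_ i) /eqP; rewrite mxE mulf_eq0 orbb => /eqP.
Qed.

Definition spd (R : realType) (m : nat) := set_type (is_spd R m).

HB.instance Definition _ (R : realType) (m : nat) :=
  Topological.copy (spd R m) (set_type (is_spd R m)).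
HB.instance Definition _ (R : realType) (m : nat) :=
  isPointed.Build (spd R m) (exist _ 1%:M (mem_set (spd1 R m))).

(* Borel sigma-algebra of the subspace topology inherited from 'M[R]_m. *)
Definition spdB (R : realType) (m : nat) :=
  g_sigma_algebraType (@open (spd R m)).

Definition is_cholesky (R : realType) (m : nat) (S L : 'M[R]_m) : Prop :=
  [/\ is_trig_mx L, forall i, 0 < L i i & S = L *m L^T].

Lemma mx11_eq (R : realType) (A B : 'M[R]_1) : A 0 0 = B 0 0 -> A = B.
Proof. by move=> h; apply/matrixP => i j; rewrite !ord1. Qed.

Lemma cholesky_exists (R : realType) (m : nat) (S : 'M[R]_m) :
  is_spd R m S -> exists L, is_cholesky S L.
Proof.
elim: m S => [S _|m IH].
  exists 0; split; first by apply/is_trig_mxP => -[].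
    by move=> [].
  by apply/matrixP => -[].
rewrite -[m.+1]/(1 + m)%N => S [Ssym Spos].
set a := S 0 0; set b := dlsubmx S; set C := drsubmx S.
have ES : S = block_mx a%:M b^T b C.
  rewrite -[S in LHS]submxK; congr block_mx.
    by apply/mx11_eq; rewrite !mxE /= mulr1n; congr (S _ _); apply/val_inj.
  by rewrite trmx_dlsub Ssym.
have quad (u : 'M[R]_1) (y : 'cV[R]_m) :
    ((col_mx u y)^T *m S *m col_mx u y) 0 0 =
    u 0 0 ^+ 2 * a + 2 * u 0 0 * (b^T *m y) 0 0 + (y^T *m C *m y) 0 0.
  rewrite ES tr_col_mx mul_row_block mul_row_col !mulmxDl.
  have -> : y^T *m b *m u = (u^T *m b^T *m y)^T.
    by rewrite !trmx_mul !trmxK mulmxA.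
  rewrite [u]mx11_scalar !tr_scalar_mx !mul_scalar_mx !mul_mx_scalar.
  rewrite -!scalemxAl !mxE /= !mulr1n; ring.
have a0 : 0 < a.
  have := Spos (col_mx (1%:M : 'M[R]_1) 0).
  rewrite quad !mulmx0 !mxE /= mulr1n expr1n mul1r mulr0 !addr0; apply.
  apply/eqP => /matrixP/(_ 0 0); rewrite mxE; case: splitP => //= j _.
  by rewrite ord1 !mxE /= => /eqP; rewrite oner_eq0.
have C'spd : is_spd R m (C - a^-1 *: (b *m b^T)).
  split.
    rewrite linearB /= linearZ /= trmx_mul trmxK; congr (_ - _).
    by rewrite /C trmx_drsub Ssym.
  move=> y y0; set t := (b^T *m y) 0 0.
  have := Spos (col_mx (- (t / a))%:M y); rewrite quad.
  have -> : (y^T *m (C - a^-1 *: (b *m b^T)) *m y) 0 0 =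
            (y^T *m C *m y) 0 0 - a^-1 * t ^+ 2.
    have bty : b^T *m y = t%:M by rewrite -mx11_scalar.
    have ytb : y^T *m b = t%:M.
      by rewrite -[LHS]trmxK trmx_mul trmxK bty tr_scalar_mx.
    rewrite mulmxBr mulmxBl -scalemxAr -scalemxAl !mulmxA ytb
      -!mulmxA bty.
    by rewrite mulmxA -scalar_mxM !mxE /= mulr1n expr2.
  rewrite -/t mxE mulr1n => h.
  suff <- : (- (t / a)) ^+ 2 * a + 2 * - (t / a) * t + (y^T *m C *m y) 0 0 =
    (y^T *m C *m y) 0 0 - a^-1 * t ^+ 2.
    apply: h; apply: contra y0 => /eqP/(congr1 dsubmx).
    by rewrite col_mxKd linear0 => ->.
  by field; rewrite gt_eqF.
have [K [Ktrig Kpos KE]] := IH _ C'spd.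
have sa0 : 0 < Num.sqrt a by rewrite sqrtr_gt0.
exists (block_mx (Num.sqrt a)%:M 0 ((Num.sqrt a)^-1 *: b) K); split.
- rewrite is_trig_block_mx // eqxx Ktrig andbT /=.
  by apply/is_trig_mxP => i j; rewrite !ord1.
- move=> i; rewrite -[i]splitK; case: (fintype.split i) => j /=.
    by rewrite block_mxEul ord1 mxE mulr1n.
  by rewrite block_mxEdr.
- rewrite tr_block_mx mulmx_block !trmx0 !mul0mx !mulmx0 !addr0 ES.
  rewrite linearZ /= -KE; congr block_mx.
  + apply/mx11_eq; rewrite tr_scalar_mx -scalar_mxM !mxE /= !mulr1n.
    by rewrite -expr2 sqr_sqrtr // ltW.
  + by rewrite mul_scalar_mx scalerA divff ?scale1r // gt_eqF.
  + by rewrite tr_scalar_mx mul_mx_scalar scalerA divff ?scale1r // gt_eqF.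
  + rewrite -scalemxAl -scalemxAr scalerA -invfM -expr2 sqr_sqrtr ?ltW //.
    by rewrite addrC subrK.
Qed.

Lemma cholesky_unique (R : realType) (m : nat) (S L M : 'M[R]_m) :
  is_cholesky S L -> is_cholesky S M -> L = M.
Proof.
elim: m S L M => [S L M _ _|m IH]; first by apply/matrixP => -[].
rewrite -[m.+1]/(1 + m)%N => S L M [Lt Lp ->] [Mt Mp].
have dec (A : 'M[R]_(1 + m)) : is_trig_mx A ->
    A = block_mx (A 0 0)%:M 0 (dlsubmx A) (drsubmx A) /\ is_trig_mx (drsubmx A).
  rewrite -{1}[A]submxK is_trig_block_mx // => /and3P[/eqP e _ ->]; split=> //.
  rewrite -{1}[A]submxK e; congr block_mx.
  by apply/mx11_eq; rewrite !mxE /= mulr1n; congr (A _ _); apply/val_inj.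
have [EL tL] := dec _ Lt; have [EM tM] := dec _ Mt.
rewrite EL EM !tr_block_mx !mulmx_block !trmx0 !mul0mx !mulmx0 !addr0.
rewrite !tr_scalar_mx -!scalar_mxM !mul_mx_scalar => /eq_block_mx[].
move=> /matrixP/(_ 0 0); rewrite !mxE /= !mulr1n -!expr2 => e _.
have e00 : L 0 0 = M 0 0.
  by apply/eqP; rewrite -(@eqrXn2 _ 2) ?ltW //; apply/eqP.
rewrite e00 => /(scalerI (lt0r_neq0 (Mp 0))) <- /addrI eK; congr block_mx.
apply: (IH _ _ _ (And3 tL _ (erefl _)) (And3 tM _ eK)) => i; rewrite !mxE.
  exact: Lp.
exact: Mp.
Qed.

(* xget picks the unique Cholesky factor when S is positive definite; the
   default 0 is never reached on [spd R m]. *)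
Definition cholesky (R : realType) (m : nat) (S : 'M[R]_m) : 'M[R]_m :=
  xget 0 [set L | is_cholesky S L].

Lemma choleskyP (R : realType) (m : nat) (S : spd R m) :
  is_cholesky (set_val S) (cholesky (set_val S)).
Proof.
have [L SL] := cholesky_exists (set_valP S).
exact: (xgetPex 0 (ex_intro [set L | is_cholesky _ L] L SL)).
Qed.

(* A listing of the strictly lower triangular positions (row, column). *)
Definition lower_enum (m : nat)
    (ord : 'I_(m * m.-1)./2 -> 'I_m * 'I_m) : Prop :=
  set_bij [set: 'I_(m * m.-1)./2] [set p : 'I_m * 'I_m | (p.2 < p.1)%N] ord.

Lemma lower_enum_exists (m : nat) :
  exists ord : 'I_(m * m.-1)./2 -> 'I_m * 'I_m, lower_enum ord.
Proof.
pose A := [pred p : 'I_m * 'I_m | (p.2 < p.1)%N].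
have cA : #|A| = (m * m.-1)./2.
  rewrite -sum1_card -(@pair_big_dep _ _ _ _ _ predT
    (fun i j : 'I_m => j < i)%N (fun _ _ => 1%N)) /=.
  rewrite -bin2 -bin2_sum big_mkord; apply: eq_bigr => i _.
  have winj : injective (widen_ord (ltnW (ltn_ord i))).
    by move=> x y /(congr1 val) /= h; apply/val_inj.
  rewrite sum1_card -[RHS]card_ord -(@fintype.card_image _ _ _ winj).
  apply: eq_card => j; apply/idP/fintype.imageP => [ji|[k _ ->]] /=.
    by exists (Ordinal (ji : (j < i)%N)) => //; apply/val_inj.
  exact: (ltn_ord k).
exists (fun i => enum_val (cast_ord (esym cA) i)); split.
- by move=> i _ /=; have := enum_valP (cast_ord (esym cA) i).
- by move=> i j _ _ /enum_val_inj /(congr1 val) /= h; apply/val_inj.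
- move=> p /= pA; exists (cast_ord cA (enum_rank_in (pA : p \in A) p)) => //.
  by rewrite cast_ordK enum_rankK_in.
Qed.

Definition cdim (m : nat) : nat := ((m * m.-1)./2 + m)%N.

Lemma cdimE (m : nat) : cdim m = (m * m.+1)./2%N.
Proof. by rewrite /cdim -bin2 -[X in (_ + X)%N]bin1 -binS bin2 mulnC. Qed.

Definition chol_coord (R : realType) (m : nat)
    (ord : 'I_(m * m.-1)./2 -> 'I_m * 'I_m) (S : spd R m) : 'cV[R]_(cdim m) :=
  let L := cholesky (set_val S) in
  col_mx (\col_i L (ord i).1 (ord i).2) (\col_i ln (L i i)).

(* The library norm on matrices is the sup norm. *)
Definition enorm (R : realType) (p : nat) (x : 'cV[R]_p) : R :=
  Num.sqrt (\sum_i x i 0 ^+ 2).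

(* Extended-real values only make +oo available as the unit of min (and -oo
   as that of max, below); for nonempty s the value is a genuine minimum. *)
Definition min_sqdist (R : realType) (p : nat) (s : seq 'cV[R]_p)
    (x : 'cV[R]_p) : \bar R :=
  \big[mine/+oo%E]_(a <- s) (enorm (x - a) ^+ 2)%:E.

(* The sample is S 0, ..., S (n - 1). *)
Definition kmeans_obj (R : realType) (m k : nat)
    (ord : 'I_(m * m.-1)./2 -> 'I_m * 'I_m) (S : nat -> spd R m) (n : nat)
    (X : k.-tuple 'cV[R]_(cdim m)) : \bar R :=
  ((n%:R^-1)%:E * \sum_(i < n) min_sqdist X (chol_coord ord (S i)))%E.

Definition Qrisk (R : realType) (m : nat)
    (ord : 'I_(m * m.-1)./2 -> 'I_m * 'I_m)
    (A : {fset 'cV[R]_(cdim m)}) (PS : probability (spdB R m) R) : \bar R :=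
  (\int[PS]_S min_sqdist A (chol_coord ord S))%E.

Definition min_risk (R : realType) (m : nat)
    (ord : 'I_(m * m.-1)./2 -> 'I_m * 'I_m) (j : nat)
    (PS : probability (spdB R m) R) : \bar R :=
  ereal_inf [set Qrisk ord A PS
            | A in [set A : {fset 'cV[R]_(cdim m)} | (1 <= #|` A| <= j)%N]].

Definition is_optimal (R : realType) (m : nat)
    (ord : 'I_(m * m.-1)./2 -> 'I_m * 'I_m) (j : nat)
    (PS : probability (spdB R m) R) (A : {fset 'cV[R]_(cdim m)}) : Prop :=
  (1 <= #|` A| <= j)%N /\ Qrisk ord A PS = min_risk ord j PS.

Definition hausdorff_dist (R : realType) (p : nat)
    (A B : {fset 'cV[R]_p}) : \bar R :=
  maxe (\big[maxe/-oo%E]_(a <- A) \big[mine/+oo%E]_(b <- B) (enorm (a - b))%:E)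
       (\big[maxe/-oo%E]_(b <- B) \big[mine/+oo%E]_(a <- A) (enorm (a - b))%:E).

Definition mutually_independent d d' (Omega : measurableType d)
    (T : measurableType d') (R : realType) (P : probability Omega R)
    (S : nat -> {RV P >-> T}) : Prop :=
  forall (J : {fset nat}) (B : nat -> set T),
    (forall i, i \in J -> measurable (B i)) ->
    (P (\bigcap_(i in [set` J]) (S i @^-1` B i)) =
     \prod_(i <- J) P (S i @^-1` B i))%E.

Definition has_law d d' (Omega : measurableType d) (T : measurableType d')
    (R : realType) (P : probability Omega R) (X : {RV P >-> T})
    (Q : probability T R) : Prop :=
  forall B, measurable B -> distribution P X B = Q B.

(* Main.v *)
(** Strong consistency follows from a law of large numbers and a compactness
    argument, in the spirit of Pollard. Almost surely the empirical means of
    countably many bounded functions (squared distances to rational finite sets,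
    truncated in value and in space) and of the squared distance to the optimal
    set A converge. Fix such a sample and an ultrafilter U on the indices that
    contains the cofinite sets: along U every component of X_n converges or
    escapes to infinity. If B is the set of finite limits, centers near B or near
    infinity do not beat B on bounded regions, so the risk of B is at most the
    limit of the empirical risks of X_n, which are bounded by those of A. Hence B
    is optimal, so B = A by uniqueness. Uniqueness also forces A to have exactly
    k points (otherwise any extra point could be added), so no center escapes.
    As U is arbitrary, the convergence holds along the whole sequence.

    The law of large numbers is proved for nonnegative integrable functions of
    pairwise independent variables by truncating at 2^j the first q 2^j terms. *)
From HB Require Import structures.
Require Import Defs.
From mathcomp Require Import all_boot all_order all_algebra finmap.
From mathcomp Require Import all_classical all_reals all_analysis.
From mathcomp Require Import measurable_realfun ring lra.
Set Implicit Arguments.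
Unset Strict Implicit.
Unset Printing Implicit Defensive.
Import Order.TTheory GRing.Theory Num.Theory.
Import numFieldNormedType.Exports.
Local Open Scope classical_set_scope.
Local Open Scope ring_scope.

(** * The strong law of large numbers *)

(** By Tonelli the series has finite integral, so it converges almost everywhere and its terms tend
    to 0. This plays the part of the Borel-Cantelli lemma. *)
Lemma ae_cvg0_summable d (T : measurableType d) (R : realType)
    (mu : {measure set T -> \bar R}) (f : nat -> T -> R) :
  (forall n, measurable_fun [set: T] (f n)) -> (forall n t, 0 <= f n t) ->
  (\sum_(n <oo) \int[mu]_t (f n t)%:E < +oo)%E ->
  {ae mu, forall t, f ^~ t @ \oo --> (0 : R)}.
Proof.
move=> mf f0 sumf.
have mEf n : measurable_fun [set: T] (fun t => (f n t)%:E).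
  exact/measurable_EFinP.
have Ef0 n t : (0 <= (f n t)%:E)%E by rewrite lee_fin.
pose F t := (\sum_(n <oo) (f n t)%:E)%E.
have F0 t : (0 <= F t)%E by exact: nneseries_ge0.
have iF : mu.-integrable [set: T] F.
  apply/integrableP; split; first exact: ge0_emeasurable_sum.
  under eq_integral do rewrite gee0_abs//.
  by rewrite integral_nneseries.
have := integrable_ae measurableT iF.
apply: filterS => t /(_ I) Ffin.
apply: cvg_series_cvg_0; apply: nondecreasing_is_cvgn.
  by apply/nondecreasing_seqP => n; rewrite seriesSr lerDl.
exists (fine (F t)) => _ [n _ <-].
rewrite -lee_fin fineK// /series/= -sumEFin big_mkord.
rewrite -(big_mkord xpredT (fun i => (f i t)%:E)).
by apply: nneseries_lim_ge => // k _ _; exact: Ef0.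
Qed.

(** This geometric sum and the next one, taken at [y = f t], make the truncation errors and the
    variances summable over the dyadic levels. *)
Lemma sum_pow2_lt_le (R : realFieldType) (y : R) (n : nat) : 0 <= y ->
  \sum_(j < n) (2 ^+ j *+ (2 ^+ j < y)%R) <= 2 * y.
Proof.
move=> y0.
(* The second bound feeds the induction: a term [2 ^+ n] is added only if [2 ^+ n < y], and the
   total is then at most [2 * 2 ^+ n]. *)
suff : (\sum_(j < n) (2 ^+ j *+ (2 ^+ j < y)%R) <= 2 * y) &&
    (\sum_(j < n) (2 ^+ j *+ (2 ^+ j < y)%R) <= (2 ^+ n : R)) by case/andP.
elim: n => [|n /andP[IH1 IH2]]; first by rewrite big_ord0 mulr_ge0// expr0 ler01.
rewrite big_ord_recr/= exprS.
have p0 : (0 : R) < 2 ^+ n by rewrite exprn_gt0.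
by case: (ltP (2 ^+ n) y) => hy; rewrite ?mulr1n ?mulr0n; apply/andP; split; lra.
Qed.

Lemma sum_sqr_div_pow2_le (R : realFieldType) (y : R) (n : nat) : 0 <= y ->
  \sum_(j < n) (y ^+ 2 / 2 ^+ j *+ (y <= 2 ^+ j)%R) <= 2 * y.
Proof.
move=> y0.
(* [phi n] bounds the tail of the geometric series from [n] on. *)
pose phi n := if y <= 2 ^+ n then 2 * (y ^+ 2 / 2 ^+ n) else 2 * y.
have phi_le n' : phi n' <= 2 * y.
  rewrite /phi; case: ifP => // yn; rewrite ler_pM2l// ler_pdivrMr ?exprn_gt0//.
  by rewrite expr2 ler_wpM2l.
have phi0 n' : 0 <= phi n'.
  by rewrite /phi; case: ifP => _; rewrite !mulr_ge0 ?invr_ge0 ?exprn_ge0 ?sqr_ge0.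
suff : \sum_(j < n) (y ^+ 2 / 2 ^+ j *+ (y <= 2 ^+ j)%R) + phi n <= 2 * y.
  by apply: le_trans; rewrite lerDl.
elim: n => [|n IH]; first by rewrite big_ord0 add0r.
rewrite big_ord_recr/=; apply: le_trans IH; rewrite -addrA lerD2l.
have [yn|yn] := leP y (2 ^+ n).
  have yn1 : y <= 2 ^+ n.+1.
    by rewrite (le_trans yn)// exprS ler_peMl ?exprn_ge0// ler1n.
  rewrite /phi yn yn1 mulr1n (exprS 2 n).
  by rewrite le_eqVlt; apply/orP; left; apply/eqP; field; rewrite gt_eqF ?exprn_gt0.
by rewrite mulr0n add0r (_ : phi n = 2 * y)// /phi leNgt yn.
Qed.

(** * Moments of sums under pairwise independence *)

Section pairwise_independent_sample.
Local Open Scope ereal_scope.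
Context d d' (Omega : measurableType d) (T : measurableType d') (R : realType).
Context (P : probability Omega R) (Q : probability T R).
Context (S : nat -> {RV P >-> T}).

Lemma ge0_integral_law (X : {RV P >-> T}) (f : T -> \bar R) :
  has_law X Q -> measurable_fun [set: T] f -> (forall t, 0 <= f t) ->
  \int[P]_w f (X w) = \int[Q]_t f t.
Proof.
move=> XQ mf f0; rewrite -(ge0_integral_distribution X mf f0).
by apply: eq_measure_integral => A mA _; exact: XQ.
Qed.

Definition pairwise_independent := forall i j, i != j ->
  forall A B, measurable A -> measurable B ->
  P (S i @^-1` A `&` S j @^-1` B) = P (S i @^-1` A) * P (S j @^-1` B).

Hypothesis S_law : forall i, has_law (S i) Q.
Hypothesis S_indep : pairwise_independent.

(** The joint law of the two variables agrees with [Q \x Q] on rectangles, hence everywhere, and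
    Tonelli splits the integral. *)
Lemma ge0_integral_indepM i j (f g : T -> \bar R) : i != j ->
    measurable_fun [set: T] f -> (forall t, 0 <= f t) ->
    measurable_fun [set: T] g -> (forall t, 0 <= g t) ->
  \int[P]_w (f (S i w) * g (S j w)) = \int[Q]_t f t * \int[Q]_t g t.
Proof.
move=> ij mf f0 mg g0.
pose Z w := (S i w, S j w).
have mZ : measurable_fun [set: Omega] Z by exact: measurable_fun_pair.
pose ZRV : {RV P >-> (T * T)%type} := HB.pack Z (isMeasurableFun.Build _ _ _ _ _ mZ).
pose h (z : (T * T)%type) := f z.1 * g z.2.
have mh : measurable_fun [set: (T * T)%type] h.
  apply: emeasurable_funM; [exact: (measurableT_comp mf)|].
  exact: (measurableT_comp mg).
have h0 z : 0 <= h z by rewrite /h mule_ge0.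
rewrite -[LHS](ge0_integral_distribution ZRV mh h0).
have ZE A : measurable A -> distribution P ZRV A = (Q \x Q) A.
  move=> mA; apply/esym/(product_measure_unique (m1 := Q) (m2 := Q)) => //.
  move=> B C mB mC; apply: (etrans (S_indep ij mB mC)).
  by congr (_ * _); exact: S_law.
rewrite (eq_measure_integral (Q \x Q)); last by move=> A mA _; exact: ZE.
rewrite (fubini_tonelli1 h)//.
transitivity (\int[Q]_t (f t * \int[Q]_u g u)).
  by apply: eq_integral => t _; rewrite /fubini_F /h /= ge0_integralZl.
by rewrite ge0_integralZr// integral_ge0.
Qed.

(** Pairwise independence removes the covariances, and each variance is at most the raw second
    moment, which may be infinite here. *)
Lemma second_moment_deviation (f : T -> R) (mu : R) (N : nat) :
    measurable_fun [set: T] f -> (forall t, 0 <= f t)%R ->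
    \int[Q]_t (f t)%:E = mu%:E ->
  \int[P]_w ((\sum_(i < N) f (S i w) - N%:R * mu) ^+ 2)%:E <=
    N%:R%:E * \int[Q]_t ((f t) ^+ 2)%:E.
Proof.
move=> mf f0 Efmu.
have mu0 : (0 <= mu)%R.
  by rewrite -lee_fin -Efmu integral_ge0// => t _; rewrite lee_fin.
pose s w := (\sum_(i < N) f (S i w))%R.
have mfS i : measurable_fun [set: Omega] (fun w => f (S i w)).
  exact: measurableT_comp.
have ms : measurable_fun [set: Omega] s by exact: measurable_sum.
have s0 w : (0 <= s w)%R by apply: sumr_ge0.
have mEf : measurable_fun [set: T] (fun t => (f t)%:E) by exact/measurable_EFinP.
have Ef0 t : 0 <= (f t)%:E by rewrite lee_fin.
have mEs : measurable_fun [set: Omega] (fun w => (s w)%:E) by exact/measurable_EFinP.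
have Es0 w : 0 <= (s w)%:E by rewrite lee_fin.
have Es : \int[P]_w (s w)%:E = (N%:R * mu)%:E.
  under eq_integral do rewrite /s -sumEFin.
  rewrite ge0_integral_sum//; last by move=> i; exact/measurable_EFinP.
  transitivity (\sum_(i < N) mu%:E).
    by apply: eq_bigr => i _; rewrite (ge0_integral_law (S_law i) mEf).
  by rewrite sumEFin sumr_const card_ord mulr_natl.
(* The diagonal terms give the second moments; each off-diagonal term gives [mu ^+ 2], and their
   number is rounded up to the square of [N]. *)
have Es2 : \int[P]_w ((s w) ^+ 2)%:E <=
    N%:R%:E * \int[Q]_t ((f t) ^+ 2)%:E + ((N%:R * mu) ^+ 2)%:E.
  have -> : \int[P]_w ((s w) ^+ 2)%:E =
      \int[P]_w (\sum_(i < N) \sum_(j < N) (f (S i w) * f (S j w))%:E).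
    apply: eq_integral => w _.
    rewrite /s expr2 mulr_suml -sumEFin; apply: eq_bigr => i _.
    by rewrite mulr_sumr -sumEFin.
  have mfSS i j : measurable_fun [set: Omega] (fun w => (f (S i w) * f (S j w))%:E).
    by apply/measurable_EFinP; exact: measurable_funM.
  have fSS0 i j w : 0 <= (f (S i w) * f (S j w))%:E by rewrite lee_fin mulr_ge0.
  rewrite ge0_integral_sum//; first last.
    - by move=> i w _; apply: sume_ge0 => j _.
    - by move=> i; apply: emeasurable_sum.
  have le_i (i : 'I_N) : true ->
      \int[P]_w (\sum_(j < N) (f (S i w) * f (S j w))%:E) <=
      \int[Q]_t ((f t) ^+ 2)%:E + (N%:R * mu ^+ 2)%:E.
    move=> _; rewrite ge0_integral_sum//.
    rewrite (bigD1 i)//=; apply: leeD.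
      rewrite -(ge0_integral_law (S_law i))//.
      - exact/measurable_EFinP/measurable_funX.
      - by move=> t; rewrite lee_fin sqr_ge0.
    apply: (@le_trans _ _ (\sum_(j < N | j != i) (mu ^+ 2)%:E)).
      apply: lee_sum => j ji.
      have ij : (i != j :> nat) by apply: contra ji => /eqP/val_inj ->.
      by rewrite expr2 EFinM -Efmu -(ge0_integral_indepM ij mEf Ef0 mEf Ef0).
    rewrite sumEFin lee_fin sumr_const -[leLHS]mulr_natl ler_wpM2r ?sqr_ge0//.
    by rewrite ler_nat (leq_trans (max_card _))// card_ord.
  apply: (le_trans (lee_sum _ le_i)).
  rewrite big_split/= sumEFin !sumr_const !card_ord.
  rewrite (_ : (N%:R * mu) ^+ 2 = N%:R * mu ^+ 2 *+ N)%R; last first.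
    by rewrite exprMn -[in RHS]mulr_natl mulrA -expr2.
  by apply: leeD; rewrite ?mule_natl.
(* This integrates [(s - c) ^+ 2 + 2 * c * s = s ^+ 2 + c ^+ 2] with [c = N%:R * mu], kept additive
   because the integral of [s ^+ 2] may be infinite. *)
have Edev : \int[P]_w ((s w - N%:R * mu) ^+ 2)%:E + ((N%:R * mu) ^+ 2 *+ 2)%:E =
    \int[P]_w ((s w) ^+ 2)%:E + ((N%:R * mu) ^+ 2)%:E.
  have c0 : (0 <= 2 * (N%:R * mu))%R by rewrite !mulr_ge0.
  have -> : ((N%:R * mu) ^+ 2 *+ 2)%:E =
      \int[P]_w ((2 * (N%:R * mu)) * s w)%:E.
    under eq_integral do rewrite EFinM.
    by rewrite ge0_integralZl_EFin// Es -EFinM; congr (_%:E); ring.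
  have -> : ((N%:R * mu) ^+ 2)%:E = \int[P]_w (cst ((N%:R * mu) ^+ 2)%:E w).
    by rewrite integral_cst// [X in _ * X]probability_setT mule1.
  have mcs : measurable_fun [set: Omega] (fun w => (2 * (N%:R * mu) * s w)%:E).
    by apply/measurable_EFinP; exact: measurable_funM.
  have mdev : measurable_fun [set: Omega] (fun w => ((s w - N%:R * mu) ^+ 2)%:E).
    by apply/measurable_EFinP; apply: measurable_funX; exact: measurable_funB.
  have ms2 : measurable_fun [set: Omega] (fun w => ((s w) ^+ 2)%:E).
    by apply/measurable_EFinP; exact: measurable_funX.
  have sqr_ge0E (x : R) : 0 <= (x ^+ 2)%:E by rewrite lee_fin sqr_ge0.
  have cs0 w : 0 <= (2 * (N%:R * mu) * s w)%:E by rewrite lee_fin !mulr_ge0.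
  rewrite -ge0_integralD// -ge0_integralD//; last by move=> w _; exact: sqr_ge0E.
  by apply: eq_integral => w _; rewrite /= -!EFinD; congr (_%:E); ring.
rewrite -(@leeD2rE _ ((N%:R * mu) ^+ 2 *+ 2)%:E)// Edev.
by rewrite mulr2n EFinD addeA leeD2r.
Qed.
End pairwise_independent_sample.

(** * Truncation and the law of large numbers along the indices [q * 2 ^ j] *)

Section strong_law.
Context d d' (Omega : measurableType d) (T : measurableType d') (R : realType).
Context (P : probability Omega R) (Q : probability T R).
Context (S : nat -> {RV P >-> T}).
Hypothesis S_law : forall i, has_law (S i) Q.
Hypothesis S_indep : pairwise_independent S.
Context (f : T -> R) (mu : R).
Hypothesis mf : measurable_fun [set: T] f.
Hypothesis f0 : forall t, 0 <= f t.
Hypothesis Efmu : (\int[Q]_t (f t)%:E = mu%:E)%E.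

Let trunc j t := f t *+ (f t <= 2 ^+ j)%R.
(** The indicator that truncation at level [j] changes the value, not the amount removed. *)
Let excess j t : R := (2 ^+ j < f t)%R%:R.

Let trunc_ge0 j t : 0 <= trunc j t.
Proof. by rewrite /trunc mulrn_wge0. Qed.

Let measurable_trunc j : measurable_fun [set: T] (trunc j).
Proof.
rewrite (_ : trunc j = fun t => if f t <= 2 ^+ j then f t else 0); last first.
  by apply/funext => t; rewrite /trunc; case: (f t <= _).
by apply: measurable_fun_ifT => //; exact: measurable_fun_ler.
Qed.

Let measurable_excess j : measurable_fun [set: T] (excess j).
Proof.
rewrite (_ : excess j = fun t => if 2 ^+ j < f t then 1 else 0); last first.
  by apply/funext => t; rewrite /excess; case: (_ < _).
by apply: measurable_fun_ifT => //; exact: measurable_fun_ltr.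
Qed.

Let trunc_mean j : R := fine (\int[Q]_t (trunc j t)%:E)%E.

Let trunc_meanE j : (\int[Q]_t (trunc j t)%:E = (trunc_mean j)%:E)%E.
Proof.
rewrite /trunc_mean fineK// ge0_fin_numE; last first.
  by apply: integral_ge0 => t _; rewrite lee_fin.
apply: (@le_lt_trans _ _ (\int[Q]_t (f t)%:E)%E); last by rewrite Efmu ltry.
apply: ge0_le_integral => //.
- by move=> t _; rewrite lee_fin.
- exact/measurable_EFinP.
- exact/measurable_EFinP.
- by move=> t _; rewrite lee_fin /trunc; case: (f t <= _); rewrite ?mulr1n ?mulr0n.
Qed.

Let trunc_mean_cvg : trunc_mean @ \oo --> mu.
Proof.
have pow2_nd : nondecreasing_seq (fun j => 2 ^+ j : R).
  by move=> i j ij; rewrite ler_eXn2l// ltr1n.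
have : (\int[Q]_t (trunc j t)%:E)%E @[j --> \oo] --> mu%:E.
  rewrite -Efmu (_ : (fun t => (f t)%:E) = fun t => limn (fun j => (trunc j t)%:E)).
    apply: cvg_monotone_convergence => //.
    - by move=> n; exact/measurable_EFinP.
    - by move=> n t _; rewrite lee_fin.
    - move=> t _ i j ij; rewrite lee_fin /trunc.
      case: (leP (f t) (2 ^+ i)) => fi; last by rewrite mulr0n mulrn_wge0.
      by rewrite (le_trans fi (pow2_nd _ _ ij)).
  apply/funext => t; apply/esym/cvg_lim => //; apply: cvg_EFin.
    by apply: nearW.
  apply: cvg_near_cst.
  have [n _ fn] : \forall n \near \oo, f t <= n%:R.
    exists (Num.truncn (f t)).+1 => // n /= ?.
    by rewrite (le_trans (ltW (truncnS_gt _)))// ler_nat.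
  exists n => // j /= nj; rewrite /trunc (_ : f t <= 2 ^+ j)//.
  apply: (le_trans (fn j nj)); rewrite -natrX ler_nat; exact/ltnW/ltn_expl.
by move=> /fine_cvg; rewrite /comp; under eq_fun do rewrite trunc_meanE.
Qed.

Let dev q j w : R :=
  ((\sum_(i < q * 2 ^ j) trunc j (S i w) - (q * 2 ^ j)%:R * trunc_mean j) /
   (q * 2 ^ j)%:R) ^+ 2.

Let nexcess q j w : R := \sum_(i < q * 2 ^ j) excess j (S i w).

Let measurable_dev q j : measurable_fun [set: Omega] (dev q j).
Proof.
apply: measurable_funX; apply: measurable_funM => //; apply: measurable_funB => //.
by apply: measurable_sum => i; exact: measurableT_comp.
Qed.

Let measurable_nexcess q j : measurable_fun [set: Omega] (nexcess q j).
Proof. by apply: measurable_sum => i; exact: measurableT_comp. Qed.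

(** Its [Q]-integral dominates the expectation of [dev + nexcess]: the first term comes from the
    variance of a mean of [q * 2 ^ j] terms, the second from counting the truncated ones. *)
Let bound q j t : R :=
  (q * 2 ^ j)%:R^-1 * trunc j t ^+ 2 + (q * 2 ^ j)%:R * excess j t.

Let measurable_bound q j : measurable_fun [set: T] (bound q j).
Proof.
by apply: measurable_funD; apply: measurable_funM => //; exact: measurable_funX.
Qed.

Let bound_ge0 q j t : 0 <= bound q j t.
Proof. by rewrite addr_ge0// mulr_ge0// ?invr_ge0 ?sqr_ge0. Qed.

Let sum_bound q n t : (0 < q)%N ->
  \sum_(j < n) bound q j t <= (4 * q)%:R * f t.
Proof.
move=> q0; have q1 : 1 <= q%:R :> R by rewrite ler1n.
have q_gt0 : 0 < q%:R :> R by rewrite ltr0n.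
have -> : \sum_(j < n) bound q j t =
    q%:R^-1 * (\sum_(j < n) (f t ^+ 2 / 2 ^+ j *+ (f t <= 2 ^+ j)%R)) +
    q%:R * (\sum_(j < n) (2 ^+ j *+ (2 ^+ j < f t)%R)).
  rewrite big_split/= !mulr_sumr; congr (_ + _); apply: eq_bigr => j _.
    rewrite natrM natrX invfM /trunc; case: (f t <= _).
      by rewrite !mulr1n; ring.
    by rewrite !mulr0n expr0n/= !mulr0.
  by rewrite natrM natrX /excess; case: (_ < f t);
    rewrite ?mulr1n ?mulr0n ?mulr1 ?mulr0.
have := sum_sqr_div_pow2_le n (f0 t); have := sum_pow2_lt_le n (f0 t).
move: (\sum_(_ < n) _) => a; move: (\sum_(_ < n) _) => b ha hb.
(* Each geometric sum is at most [2 * f t]; the constant 4 then comes from [q^-1 <= q]. *)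
apply: (@le_trans _ _ (q%:R^-1 * (2 * f t) + q%:R * (2 * f t))).
  by rewrite lerD// ler_pM2l// invr_gt0.
rewrite natrM; have : q%:R^-1 <= q%:R :> R by rewrite (le_trans _ q1)// invf_le1.
move: (q%:R^-1) => c cq; have := f0 t; nra.
Qed.

Let integral_dev_nexcess q j : (0 < q)%N ->
  (\int[P]_w (dev q j w + nexcess q j w)%:E <= \int[Q]_t (bound q j t)%:E)%E.
Proof.
move=> q0; have N0 : 0 < (q * 2 ^ j)%:R :> R by rewrite ltr0n muln_gt0 q0 expn_gt0.
set N := (q * 2 ^ j)%N in N0 *.
have dev0 w : (0 <= (dev q j w)%:E)%E by rewrite lee_fin sqr_ge0.
have nex0 w : (0 <= (nexcess q j w)%:E)%E by rewrite lee_fin sumr_ge0.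
have mdev : measurable_fun [set: Omega] (fun w => (dev q j w)%:E).
  exact/measurable_EFinP.
have mnex : measurable_fun [set: Omega] (fun w => (nexcess q j w)%:E).
  exact/measurable_EFinP.
have mtr2 : measurable_fun [set: T] (fun t => (trunc j t ^+ 2)%:E).
  by apply/measurable_EFinP; exact: measurable_funX.
have tr20 t : (0 <= (trunc j t ^+ 2)%:E)%E by rewrite lee_fin sqr_ge0.
have mex : measurable_fun [set: T] (fun t => (excess j t)%:E).
  exact/measurable_EFinP.
have ex0 t : (0 <= (excess j t)%:E)%E by rewrite lee_fin.
have N0' := ltW N0.
have NV0 : 0 <= N%:R^-1 :> R by rewrite invr_ge0.
have -> : (\int[Q]_t (bound q j t)%:E = (N%:R^-1)%:E * \int[Q]_t (trunc j t ^+ 2)%:E +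
    N%:R%:E * \int[Q]_t (excess j t)%:E)%E.
  rewrite -!ge0_integralZl_EFin// -ge0_integralD//.
  - by move=> t _; rewrite mule_ge0.
  - exact: measurable_funeM.
  - by move=> t _; rewrite mule_ge0.
  - exact: measurable_funeM.
under eq_integral do rewrite EFinD.
rewrite ge0_integralD//; apply: leeD.
  have -> : (\int[P]_w (dev q j w)%:E = ((N%:R^-1) ^+ 2)%:E *
     \int[P]_w ((\sum_(i < N) trunc j (S i w) - N%:R * trunc_mean j) ^+ 2)%:E)%E.
    rewrite -ge0_integralZl_EFin ?sqr_ge0//.
    - by apply: eq_integral => w _; rewrite /dev exprMn mulrC EFinM.
    - by move=> w _; rewrite lee_fin sqr_ge0.
    - apply/measurable_EFinP/measurable_funX/measurable_funB => //.
      by apply: measurable_sum => i; exact: measurableT_comp.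
  apply: le_trans.
    apply: lee_wpmul2l (second_moment_deviation S_law S_indep N
      (measurable_trunc j) (trunc_ge0 j) (trunc_meanE j)).
    by rewrite lee_fin sqr_ge0.
  by rewrite muleA -EFinM expr2 -mulrA mulVf ?gt_eqF// mulr1.
rewrite /nexcess; under eq_integral do rewrite -sumEFin.
rewrite ge0_integral_sum//; last first.
  by move=> i; apply/measurable_EFinP; exact: measurableT_comp.
under eq_bigr => i _ do rewrite (ge0_integral_law (S_law i) mex ex0).
by rewrite sumr_const card_ord mule_natl.
Qed.

(** The expectations of [dev + nexcess] add up to at most [(4 * q)%:R * mu], so both tend to 0
    almost surely: the truncated means approach [trunc_mean], and eventually no term of the block is
    truncated. *)
Lemma dyadic_strong_law q : (0 < q)%N ->
  {ae P, forall w, (q * 2 ^ j)%:R^-1 * \sum_(i < q * 2 ^ j) f (S i w)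
    @[j --> \oo] --> mu}.
Proof.
move=> q0.
have : {ae P, forall w, dev q j w + nexcess q j w @[j --> \oo] --> (0 : R)}.
  apply: (ae_cvg0_summable (f := fun j w => dev q j w + nexcess q j w)).
  - by move=> j; exact: measurable_funD.
  - by move=> j w; rewrite addr_ge0 ?sqr_ge0 ?sumr_ge0.
  apply: (@le_lt_trans _ _ (\sum_(j <oo) \int[Q]_t (bound q j t)%:E)%E).
    apply: lee_nneseries => [j _ _|j _]; last exact: integral_dev_nexcess.
    by apply: integral_ge0 => w _; rewrite lee_fin addr_ge0 ?sqr_ge0 ?sumr_ge0.
  have mbE j : measurable_fun [set: T] (fun t => (bound q j t)%:E).
    exact/measurable_EFinP.
  rewrite -integral_nneseries//; last by move=> j t _; rewrite lee_fin.
  apply: (@le_lt_trans _ _ (\int[Q]_t ((4 * q)%:R%:E * (f t)%:E))%E).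
    have mfE : measurable_fun [set: T] (fun t => (f t)%:E) by exact/measurable_EFinP.
    apply: ge0_le_integral => //.
    - by move=> t _; apply: nneseries_ge0 => j _ _; rewrite lee_fin.
    - by apply: ge0_emeasurable_sum => // j t _ _; rewrite lee_fin.
    - exact: measurable_funeM.
    move=> t _; apply: lime_le.
      by apply: is_cvg_nneseries => j _ _; rewrite lee_fin.
    by apply: nearW => n; rewrite big_mkord sumEFin -EFinM lee_fin sum_bound.
  rewrite ge0_integralZl_EFin ?Efmu ?ltry//.
  - by move=> t _; rewrite lee_fin.
  - exact/measurable_EFinP.
apply: filterS => w cvg0.
have N0 j : 0 < (q * 2 ^ j)%:R :> R by rewrite ltr0n muln_gt0 q0 expn_gt0.
have nex_le j : 0 <= nexcess q j w <= dev q j w + nexcess q j w.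
  by rewrite sumr_ge0//= lerDr sqr_ge0.
have dev_le j : 0 <= dev q j w <= dev q j w + nexcess q j w.
  by rewrite sqr_ge0/= lerDl sumr_ge0.
have dev_cvg : dev q j w @[j --> \oo] --> (0 : R).
  by apply: squeeze_cvgr cvg0; [apply: nearW => j; exact: dev_le|exact: cvg_cst].
have nex_cvg : nexcess q j w @[j --> \oo] --> (0 : R).
  by apply: squeeze_cvgr cvg0; [apply: nearW => j; exact: nex_le|exact: cvg_cst].
have eqsum : \forall j \near \oo,
    (q * 2 ^ j)%:R^-1 * (\sum_(i < q * 2 ^ j) trunc j (S i w)) =
    (q * 2 ^ j)%:R^-1 * \sum_(i < q * 2 ^ j) f (S i w).
  near=> j; congr (_ * _); apply: eq_bigr => i _.
  (* A count below 1 is 0, so truncation leaves the whole block unchanged. *)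
  have : nexcess q j w < 1.
    rewrite -(ger0_norm (proj1 (andP (nex_le j)))).
    by near: j; move/cvgr0Pnorm_lt : nex_cvg; apply.
  rewrite /nexcess (bigD1 i)//= /trunc /excess; case: (leP (f (S i w))) => // _.
  by rewrite ltNge lerDl sumr_ge0.
apply: (cvg_trans (near_eq_cvg eqsum)); rewrite -[mu]add0r.
rewrite (_ : (fun j => _) = fun j =>
   ((q * 2 ^ j)%:R^-1 * (\sum_(i < q * 2 ^ j) trunc j (S i w)) - trunc_mean j) +
   trunc_mean j); last first.
  by apply/funext => j; rewrite subrK.
apply: cvgD trunc_mean_cvg.
apply/cvgr0Pnorm_lt => e e0.
move/cvgr0Pnorm_lt : dev_cvg => /(_ (e ^+ 2)); rewrite exprn_gt0// => /(_ isT).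
apply: filterS => j; rewrite ger0_norm ?sqr_ge0// => h.
rewrite -(@ltr_pXn2r _ 2)// ?nnegrE//; last exact: ltW.
rewrite -normrX ger0_norm ?sqr_ge0//.
apply: le_lt_trans h; rewrite le_eqVlt; apply/orP; left; apply/eqP.
by rewrite /dev mulrBl mulrC (mulrC _%:R) mulfK ?gt_eqF.
Unshelve. all: by end_near. Qed.
End strong_law.
(* With [L * 2 ^ j <= n < 2 * L * 2 ^ j], the mean over [n] is squeezed between the
   means over the multiples [q * 2 ^ j] and [q.+1 * 2 ^ j] that enclose [n], at
   a relative cost [1 / L]. *)
Lemma cvg_mean_dyadic (R : realType) (u : nat -> R) (mu : R) :
  (forall i, 0 <= u i) ->
  (forall q, (0 < q)%N ->
    (q * 2 ^ j)%:R^-1 * \sum_(i < q * 2 ^ j) u i @[j --> \oo] --> mu) ->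
  n%:R^-1 * \sum_(i < n) u i @[n --> \oo] --> mu.
Proof.
move=> u0 dyad; pose s n := \sum_(i < n) u i.
have s_ge0 n : 0 <= s n by exact: sumr_ge0.
have s_le m n : (m <= n)%N -> s m <= s n.
  move=> mn; rewrite /s -!(big_mkord xpredT u) [leRHS](big_cat_nat (n := m))//=.
  by rewrite lerDl sumr_ge0.
have mu0 : 0 <= mu.
  by apply: (cvgr_to_ge (dyad 1%N isT)); apply: nearW => j;
    rewrite mulr_ge0 ?invr_ge0 ?sumr_ge0.
apply/cvgrPdist_le => e0 e0_gt0.
pose e := e0 / 2; have e_gt0 : 0 < e by rewrite divr_gt0.
(* Chosen so that one more block of [2 ^ j] terms, which costs [(mu + e) * 2 ^ j], stays below
   [e * n]. *)
pose L := (Num.truncn ((mu + e) / e)).+1.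
have Le : mu + e <= e * L%:R.
  by rewrite mulrC -ler_pdivrMr// ltW// truncnS_gt.
(* Only the finitely many [q <= 2 * L] occur, so one threshold [J] serves them all. *)
have [J _ HJ] : \forall j \near \oo, forall q : 'I_(2 * L).+1, (0 < q)%N ->
    `|mu - (q * 2 ^ j)%:R^-1 * s (q * 2 ^ j)%N| <= e.
  apply: filter_forall => q; case: (posnP q) => [|q0]; first by move=> _; exact: nearW.
  have /cvgrPdist_le/(_ _ e_gt0) := dyad q q0.
  by apply: filterS => j.
exists (L * 2 ^ J)%N => // n /= Jn.
(* With [2 ^ j <= n %/ L < 2 ^ j.+1], the quotient [q] lies between [L] and [2 * L]. *)
pose j := trunc_log 2 (n %/ L); pose q := (n %/ 2 ^ j)%N.
have nL : (0 < n %/ L)%N by rewrite divn_gt0// (leq_trans _ Jn)// leq_pmulr// expn_gt0.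
have jn : (2 ^ j <= n %/ L < 2 ^ j.+1)%N by exact: trunc_log_bounds.
have Jj : (J <= j)%N.
  by rewrite trunc_log_max// leq_divRL// mulnC.
have [jn1 jn2] := andP jn.
have p0 : (0 < 2 ^ j)%N by rewrite expn_gt0.
have Lq : (L <= q)%N by rewrite leq_divRL// mulnC -leq_divRL.
have qL : (q < 2 * L)%N.
  by rewrite ltn_divLR// -mulnA (mulnC L) mulnA -expnS -ltn_divLR.
have qn : (q * 2 ^ j <= n)%N by exact: leq_trunc_div.
have nq : (n < q.+1 * 2 ^ j)%N by rewrite ltn_ceil.
have q0 : (0 < q)%N by exact: leq_trans Lq.
have n0 : 0 < n%:R :> R by rewrite ltr0n (leq_trans _ qn)// muln_gt0 q0.
have HJq r : (0 < r)%N -> (r <= 2 * L)%N ->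
    (mu - e) * (r%:R * (2 ^ j)%:R) <= s (r * 2 ^ j)%N <= (mu + e) * (r%:R * (2 ^ j)%:R).
  move=> r0 rL; have := HJ j Jj (Ordinal (rL : (r < (2 * L).+1)%N)) r0 => /=.
  have rp0 : 0 < (r * 2 ^ j)%:R :> R by rewrite ltr0n muln_gt0 r0.
  rewrite -natrM distrC ler_distl mulrC ler_pdivlMr// ler_pdivrMr//.
have /andP[lo _] := HJq q q0 (ltnW qL).
have /andP[_ hi] := HJq q.+1 isT qL.
have lo' := le_trans lo (s_le _ _ qn).
have hi' := le_trans (s_le _ _ (ltnW nq)) hi.
have e0E : e0 = 2 * e by rewrite /e; field.
rewrite distrC ler_distl mulrC ler_pdivlMr// ler_pdivrMr// e0E.
have p0R : 0 < (2 ^ j)%:R :> R by rewrite ltr0n.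
have qnR : q%:R * (2 ^ j)%:R <= n%:R :> R by rewrite -natrM ler_nat.
have nqR : n%:R <= (q%:R + 1) * (2 ^ j)%:R :> R by rewrite natr1 -natrM ler_nat ltnW.
have LqR : L%:R <= q%:R :> R by rewrite ler_nat.
have hepn : (mu + e) * (2 ^ j)%:R <= e * n%:R.
  apply: (@le_trans _ _ (e * L%:R * (2 ^ j)%:R)); first by rewrite ler_pM2r.
  rewrite -mulrA ler_pM2l//; by apply: le_trans qnR; rewrite ler_pM2r.
rewrite -/(s n); move: hi'; rewrite -natr1 => hi'.
move: (s n) (s_ge0 n) lo' hi' p0R qnR nqR hepn n0 => sn sn0.
move: (2 ^ j)%:R (n%:R : R) (q%:R : R) => p N Q lo' hi' p0R qnR nqR hepn N0.
apply/andP; split; last by nra.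
(* If [mu <= e], the lower bound to be proved is nonpositive and [0 <= sn] is enough. *)
have [mue|mue] := leP mu e; last by nra.
by apply: le_trans sn0; nra.
Qed.

Lemma strong_law d d' (Omega : measurableType d) (T : measurableType d')
    (R : realType) (P : probability Omega R) (Q : probability T R)
    (S : nat -> {RV P >-> T}) (f : T -> R) (mu : R) :
  (forall i, has_law (S i) Q) -> pairwise_independent S ->
  measurable_fun [set: T] f -> (forall t, 0 <= f t) ->
  (\int[Q]_t (f t)%:E = mu%:E)%E ->
  {ae P, forall w, n%:R^-1 * \sum_(i < n) f (S i w) @[n --> \oo] --> mu}.
Proof.
move=> S_law S_indep mf f0 Efmu.
have := ae_foralln (fun q => dyadic_strong_law S_law S_indep mf f0 Efmu (ltn0Sn q)).
apply: filterS => w dyad.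
apply: (cvg_mean_dyadic (u := fun i => f (S i w))) => // -[//|q] _.
exact: dyad.
Qed.
(** * Measurability of the Cholesky coordinates *)

Lemma measurable_spd_entry (R : realType) (m : nat) (i j : 'I_m) :
  measurable_fun [set: spdB R m] (fun S : spdB R m => (set_val S : 'M[R]_m) i j).
Proof.
pose g (S : spd R m) := (set_val S : 'M[R]_m) i j.
have cg : continuous g.
  move=> S.
  apply: (@continuous_comp _ _ _ (set_val : spd R m -> 'M[R]_m) (fun M => M i j)).
    exact: initial_continuous.
  exact: coord_continuous.
apply: (measurability _ (RGenOpens.measurableE R)) => _ [_ [a [b ->] <-]].
rewrite setTI; apply: sub_sigma_algebra.
by move/continuousP : cg; apply; exact: interval_open.
Qed.

Lemma measurable_fun_div d (T : measurableType d) (R : realType) (f g : T -> R) :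
  measurable_fun [set: T] f -> measurable_fun [set: T] g ->
  (forall t, 0 < g t) -> measurable_fun [set: T] (fun t => f t / g t).
Proof.
move=> mf mg g0.
(* Positivity of [g] turns the inverse into a composite of the measurable functions [expR] and
   [ln]. *)
rewrite (_ : (fun t => f t / g t) = fun t => f t * expR (- ln (g t))); last first.
  by apply/funext => t; rewrite expRN lnK// posrE.
apply: measurable_funM => //; apply: measurableT_comp => //.
by apply: measurableT_comp => //; exact: measurableT_comp.
Qed.

(** Triangularity kills the terms beyond [j]. Isolating the term [k = j] lets column [j] of [L] be
    computed from the columns before it. *)
Lemma cholesky_entryE (R : realType) (m : nat) (S L : 'M[R]_m) (i j : 'I_m) :
  is_cholesky S L ->
  S i j = \sum_(k < m | (k < j)%N) L i k * L j k + L i j * L j j.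
Proof.
case=> /is_trig_mxP Lt _ ->; rewrite mxE.
under eq_bigr do rewrite mxE.
rewrite (bigID (fun k : 'I_m => (k < j)%N))/=; congr (_ + _).
rewrite (bigD1 j) ?ltnn//= big1 ?addr0// => k /andP[jk kj].
by rewrite (Lt j k) ?mulr0// ltn_neqAle leqNgt jk andbT eq_sym.
Qed.

Lemma measurable_cholesky_entry d (T : measurableType d) (R : realType) (m : nat)
    (S L : T -> 'M[R]_m) :
  (forall i j, measurable_fun [set: T] (fun t => S t i j)) ->
  (forall t, is_cholesky (S t) (L t)) ->
  forall i j, measurable_fun [set: T] (fun t => L t i j).
Proof.
(* Strong induction on the column [j], for all rows at once. *)
move=> mS SL i j; have [n] := ubnP (j : nat).
elim: n => // n IH in i j *; rewrite ltnS => jn.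
have Lpos t k : 0 < L t k k by have [_ ->] := SL t.
have mpart i' : measurable_fun [set: T]
    (fun t => S t i' j - \sum_(k < m | (k < j)%N) L t i' k * L t j k).
  apply: measurable_funB => //.
  under eq_fun do rewrite big_mkcond/=.
  apply: measurable_sum => k; case: (boolP (k < j)%N) => kj; last exact: measurable_cst.
  by apply: measurable_funM; apply: IH; exact: leq_trans kj jn.
(* On the diagonal the isolated term is [L t j j ^+ 2], and positivity selects the square root; the
   other rows then divide by this entry. *)
have mdiag : measurable_fun [set: T] (fun t => L t j j).
  rewrite (_ : (fun t => _) = fun t => Num.sqrt
     (S t j j - \sum_(k < m | (k < j)%N) L t j k * L t j k)); last first.
    apply/funext => t; rewrite (cholesky_entryE j j (SL t)) addrC addKr.
    by rewrite -expr2 sqrtr_sqr gtr0_norm.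
  apply: measurableT_comp => //; apply: continuous_measurable_fun.
  exact: sqrt_continuous.
rewrite (_ : (fun t => _) = fun t =>
  (S t i j - \sum_(k < m | (k < j)%N) L t i k * L t j k) / L t j j); last first.
  by apply/funext => t; rewrite (cholesky_entryE i j (SL t)) addrC addKr mulfK// gt_eqF.
exact: measurable_fun_div.
Qed.

Lemma measurable_chol_coord (R : realType) (m : nat)
    (ord : 'I_(m * m.-1)./2 -> 'I_m * 'I_m) (i : 'I_(cdim m)) :
  measurable_fun [set: spdB R m] (fun S : spdB R m => chol_coord ord S i 0).
Proof.
have mL := measurable_cholesky_entry (@measurable_spd_entry R m) (@choleskyP R m).
rewrite /chol_coord -[i]splitK; case: (fintype.split i) => k /=.
  under eq_fun do rewrite col_mxEu mxE.
  exact: mL.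
under eq_fun do rewrite col_mxEd mxE.
by apply: measurableT_comp => //; exact: mL.
Qed.
(** * Squared distance to a finite set of centers *)

Section squared_distance.
Context (R : realType) (p : nat).
Implicit Types (x y v a b : 'cV[R]_p) (s : seq 'cV[R]_p).

Lemma enorm_ge0 x : 0 <= enorm x.
Proof. exact: sqrtr_ge0. Qed.

Lemma sqr_enorm x : enorm x ^+ 2 = \sum_i x i 0 ^+ 2.
Proof. by rewrite sqr_sqrtr// sumr_ge0// => i _; exact: sqr_ge0. Qed.

Lemma enormN x : enorm (- x) = enorm x.
Proof. by congr Num.sqrt; apply: eq_bigr => i _; rewrite mxE sqrrN. Qed.

(** Young's inequality in each coordinate, from [0 <= (e * c - f) ^+ 2 / e]. It takes the place of
    the triangle inequality at the level of squares. *)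
Lemma sqr_enormD_le (e : R) x y : 0 < e ->
  enorm (x + y) ^+ 2 <= (1 + e) * enorm x ^+ 2 + (1 + e^-1) * enorm y ^+ 2.
Proof.
move=> e0; rewrite !sqr_enorm !mulr_sumr -big_split/=; apply: ler_sum => i _.
rewrite mxE; move: (x i 0) (y i 0) => c f.
have : 0 <= (e * c - f) ^+ 2 / e by rewrite divr_ge0 ?sqr_ge0// ltW.
rewrite (_ : (e * c - f) ^+ 2 / e = e * c ^+ 2 - 2 * c * f + e^-1 * f ^+ 2); last first.
  by field; rewrite gt_eqF.
by move: (e^-1) => ei; nra.
Qed.

Lemma le_min_sqdist (y : \bar R) s x :
  (y <= min_sqdist s x)%E = all (fun a => (y <= (enorm (x - a) ^+ 2)%:E)%E) s.
Proof.
rewrite /min_sqdist; elim: s => [|a s IH]; first by rewrite big_nil leey.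
by rewrite big_cons le_min IH.
Qed.

Lemma min_sqdist_ge0 s x : (0 <= min_sqdist s x)%E.
Proof. by rewrite le_min_sqdist; apply/allP => a _; rewrite lee_fin sqr_ge0. Qed.

Lemma min_sqdist_le s x a : a \in s -> (min_sqdist s x <= (enorm (x - a) ^+ 2)%:E)%E.
Proof.
by move=> sa; have := lexx (min_sqdist s x); rewrite le_min_sqdist => /allP; exact.
Qed.

Lemma min_sqdist_nil x : min_sqdist [::] x = +oo%E.
Proof. by rewrite /min_sqdist big_nil. Qed.

Lemma min_sqdist_sub s s' x : {subset s <= s'} -> (min_sqdist s' x <= min_sqdist s x)%E.
Proof.
by move=> ss'; rewrite le_min_sqdist; apply/allP => a /ss'; exact: min_sqdist_le.
Qed.

Lemma min_sqdist_fin_num s x a : a \in s -> min_sqdist s x \is a fin_num.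
Proof.
move=> sa; rewrite ge0_fin_numE ?min_sqdist_ge0//.
exact: le_lt_trans (min_sqdist_le _ sa) (ltry _).
Qed.

(** The same [r] truncates in space and in value: averages stay bounded and far centers become
    harmless. The minimum with [r] makes [fine] safe even for empty [s]. *)
Definition trunc_sqdist (r : R) s x : R :=
  if enorm x <= r then fine (mine (min_sqdist s x) r%:E) else 0.

Lemma trunc_sqdistE (r : R) s x : 0 <= r ->
  (trunc_sqdist r s x)%:E =
    if enorm x <= r then mine (min_sqdist s x) r%:E else 0%E.
Proof.
move=> r0; rewrite /trunc_sqdist; case: ifP => // _; rewrite fineK//.
rewrite ge0_fin_numE; last by rewrite le_min min_sqdist_ge0 lee_fin.
by rewrite gt_min ltry orbT.
Qed.

Lemma trunc_sqdist_ge0 (r : R) s x : 0 <= r -> 0 <= trunc_sqdist r s x.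
Proof.
move=> r0; rewrite -lee_fin trunc_sqdistE//; case: ifP => // _.
by rewrite le_min min_sqdist_ge0 lee_fin.
Qed.

Lemma trunc_sqdist_le (r : R) s x : 0 <= r -> trunc_sqdist r s x <= r.
Proof.
by move=> r0; rewrite -lee_fin trunc_sqdistE//; case: ifP; rewrite ?ge_min ?lexx ?orbT.
Qed.

Lemma trunc_sqdist_le_min (r : R) s x : 0 <= r ->
  ((trunc_sqdist r s x)%:E <= min_sqdist s x)%E.
Proof.
move=> r0; rewrite trunc_sqdistE//; case: ifP; rewrite ?min_sqdist_ge0//.
by rewrite ge_min lexx.
Qed.

(* A center near [s] costs a factor [1 + e]; a center that is far from the ball
   of radius [r] does not compete with the truncation level. *)
Lemma trunc_sqdist_perturb (e r : R) s s' x : 0 < e -> 0 <= r ->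
  (forall a, a \in s' -> (exists2 b, b \in s & enorm (a - b) ^+ 2 <= e ^+ 2) \/
                         2 * r ^+ 2 + 2 * r <= enorm a ^+ 2) ->
  (((trunc_sqdist r s x - (e + e ^+ 2)) / (1 + e))%:E <= min_sqdist s' x)%E.
Proof.
move=> e0 r0 near_or_far; rewrite le_min_sqdist; apply/allP => a as'.
have e1 : 0 < 1 + e by rewrite addr_gt0.
have t0 := trunc_sqdist_ge0 s x r0; have tr := trunc_sqdist_le s x r0.
have tm := trunc_sqdist_le_min s x r0.
have d0 : 0 <= enorm (x - a) ^+ 2 by exact: sqr_ge0.
rewrite lee_fin ler_pdivrMr//.
have [xr|xr] := leP (enorm x) r; last first.
  rewrite /trunc_sqdist (lt_geF xr); nra.
have [[b bs ab]|far] := near_or_far _ as'.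
  have := le_trans tm (min_sqdist_le x bs); rewrite lee_fin => tb.
  have := sqr_enormD_le (x - a) (a - b) e0; rewrite addrA subrK => h.
  (* The additive error of the statement is exactly [(1 + e^-1) * e ^+ 2]. *)
  have ee : (1 + e^-1) * enorm (a - b) ^+ 2 <= e + e ^+ 2.
    apply: (@le_trans _ _ ((1 + e^-1) * e ^+ 2)).
      by rewrite ler_pM2l// addr_gt0 ?invr_gt0.
    by rewrite le_eqVlt; apply/orP; left; apply/eqP; field; rewrite gt_eqF.
  by move: ee h tb; move: (enorm _ ^+ 2) => E1; lra.
(* On the ball, [enorm a ^+ 2 <= 2 * enorm (x - a) ^+ 2 + 2 * r ^+ 2], so the threshold on [enorm a]
   forces [r <= enorm (x - a) ^+ 2]. *)
have := sqr_enormD_le (a - x) x (@ltr01 R).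
rewrite subrK -(enormN (a - x)) opprB invr1 => h.
have x2 : enorm x ^+ 2 <= r ^+ 2 by rewrite ler_sqr ?nnegrE ?enorm_ge0.
nra.
Qed.

(** Truncating the right side as well is harmless: the left side is at most [r], and it is
    nonpositive off the ball. *)
Lemma trunc_sqdist_near (e r : R) s s' x : 0 < e -> 0 <= r ->
  (forall a, a \in s' -> exists2 b, b \in s & enorm (a - b) ^+ 2 <= e ^+ 2) ->
  (trunc_sqdist r s x - (e + e ^+ 2)) / (1 + e) <= trunc_sqdist r s' x.
Proof.
move=> e0 r0 near_s.
have e1 : 0 < 1 + e by rewrite addr_gt0.
rewrite -lee_fin [leRHS]trunc_sqdistE//; case: ifPn => xr.
  rewrite le_min (trunc_sqdist_perturb x e0 r0)/=; last by move=> a /near_s; left.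
  have tr := trunc_sqdist_le s x r0.
  by rewrite lee_fin ler_pdivrMr//; nra.
rewrite lee_fin ler_pdivrMr// mul0r /trunc_sqdist (negbTE xr).
by rewrite sub0r oppr_le0 addr_ge0 ?sqr_ge0// ltW.
Qed.

Lemma rat_approx (e : R) b : 0 < e ->
  exists q : 'cV[rat]_p, enorm (map_mx ratr q - b) ^+ 2 <= e.
Proof.
(* The tolerance per coordinate; [p.+1] instead of [p] keeps it positive in dimension 0. *)
move=> e0; pose dlt := Num.sqrt (e / p.+1%:R).
have dlt0 : 0 < dlt by rewrite sqrtr_gt0 divr_gt0.
have /choice[q qP] (i : 'I_p) : exists q : rat, ratr q \in `]b i 0 - dlt, b i 0 + dlt[.
  by apply: rat_in_itvoo; lra.
exists (\col_i q i); rewrite sqr_enorm.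
apply: (@le_trans _ _ (\sum_(i < p) dlt ^+ 2)).
  apply: ler_sum => i _; rewrite !mxE -real_normK ?num_real//.
  rewrite ler_sqr ?nnegrE//; last exact: ltW.
  by have := qP i; rewrite in_itv/= -ltr_distl; exact: ltW.
rewrite sumr_const card_ord -mulr_natl sqr_sqrtr; last by rewrite ltW// divr_gt0.
rewrite mulrCA; apply: ler_piMr; first exact: ltW.
by rewrite ler_pdivrMr// mul1r ler_nat.
Qed.

End squared_distance.
(** * Centers along an ultrafilter *)

(** By compactness of the segment the image ultrafilter has a cluster point, and an ultrafilter
    converges to each of its cluster points. *)
Lemma ultra_bounded_cvg (R : realType) (T : Type) (U : set_system T)
    (f : T -> R) (M : R) : UltraFilter U ->
  (\forall t \near U, `|f t| <= M) -> exists b : R, f @ U --> b.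
Proof.
move=> UU fM.
have [|b [_ clb]] := @segment_compact R (- M) M (fmap f U) _.
  by apply: filterS fM => t; rewrite /= in_itv/= -ler_norml.
exists b => N bN; have [//|UN] := in_ultra_setVsetC (f @^-1` N) UU.
by have [x [+ Nx]] := clb (~` N) N UN bN.
Qed.

(* [None] stands for the point at infinity of the one-point compactification. *)
Definition tends_to (R : realType) (p : nat) (T : Type) (U : set_system T)
    (y : T -> 'cV[R]_p) (l : option 'cV[R]_p) : Prop :=
  if l is Some b then forall e, 0 < e -> \forall t \near U, enorm (y t - b) ^+ 2 <= e
  else forall r, \forall t \near U, r <= enorm (y t) ^+ 2.

(** If the norms do not escape to infinity, maximality of [U] bounds them on a set of [U], and each
    coordinate then converges. *)
Lemma ultra_tends_to (R : realType) (p : nat) (T : Type) (U : set_system T)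
    (y : T -> 'cV[R]_p) : UltraFilter U -> exists l, tends_to U y l.
Proof.
move=> UU.
have [yinfty|] := pselect (forall r, \forall t \near U, r <= enorm (y t) ^+ 2).
  by exists None.
move=> /existsNP[r Nr].
have yr : \forall t \near U, enorm (y t) ^+ 2 < r.
  have [//|] := in_ultra_setVsetC [set t | r <= enorm (y t) ^+ 2] UU.
  by apply: filterS => t /= /negP; rewrite -ltNge.
have /choice[b bP] (i : 'I_p) : exists b : R, y t i 0 @[t --> U] --> b.
  apply: (@ultra_bounded_cvg _ _ _ _ (Num.sqrt r)).
  apply: filterS yr => t /ltW; rewrite sqr_enorm => yr.
  rewrite -sqrtr_sqr ler_wsqrtr// (le_trans _ yr)// (bigD1 i)//= lerDl sumr_ge0//.
  by move=> k _; exact: sqr_ge0.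
exists (Some (\col_i b i)) => e e0.
have e1 : 0 < e / p.+1%:R by rewrite divr_gt0.
have : \forall t \near U, forall i, `|b i - y t i 0| <= Num.sqrt (e / p.+1%:R).
  apply: filter_forall => i; move/cvgrPdist_le : (bP i); apply.
  by rewrite sqrtr_gt0.
apply: filterS => t yb; rewrite sqr_enorm.
apply: (@le_trans _ _ (\sum_(i < p) (e / p.+1%:R))).
  apply: ler_sum => i _; rewrite !mxE -(sqr_sqrtr (ltW e1)) -real_normK ?num_real//.
  by rewrite ler_sqr ?nnegrE ?sqrtr_ge0// distrC.
rewrite sumr_const card_ord -[leLHS]mulr_natl mulrCA; apply: ler_piMr; first exact: ltW.
by rewrite ler_pdivrMr// mul1r ler_nat.
Qed.

(** * Lower bound for the limiting empirical risk *)

Section empirical_limit.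
Context (R : realType) (p k : nat) (v : nat -> 'cV[R]_p).
Context (I : nat -> seq 'cV[R]_p -> R).
Hypothesis mean_trunc_cvg : forall (r : nat) (q : seq 'cV[rat]_p),
  n%:R^-1 * \sum_(i < n) trunc_sqdist r%:R (map (map_mx ratr) q) (v i)
    @[n --> \oo] --> I r (map (map_mx ratr) q).
Hypothesis I_near : forall (e : R) (r : nat) (s s' : seq 'cV[R]_p), 0 < e ->
  (forall a, a \in s' -> exists2 b, b \in s & enorm (a - b) ^+ 2 <= e ^+ 2) ->
  (I r s - (e + e ^+ 2)) / (1 + e) <= I r s'.

Definition emp_risk n (s : seq 'cV[R]_p) : \bar R :=
  ((n%:R^-1)%:E * \sum_(i < n) min_sqdist s (v i))%E.

(** The finite limits of the centers are moved to rational points, where the truncated means are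
    known to converge. The actual centers are then close to these points or far away, so the
    perturbation bound applies to every sample term. *)
Lemma trunc_risk_le_emp_risk (U : set_system nat) (X : nat -> k.-tuple 'cV[R]_p)
    (L : 'I_k -> option 'cV[R]_p) (c : R) (r : nat) :
  ProperFilter U -> U --> \oo ->
  (forall j, tends_to U (fun n => tnth (X n) j) (L j)) ->
  (forall e, 0 < e -> \forall n \near U, (emp_risk n (X n) <= (c + e)%:E)%E) ->
  I r (pmap L (enum 'I_k)) <= c.
Proof.
move=> UF Uoo XL Xc; set B := pmap L _.
suff main (e : R) : 0 < e ->
    I r B <= (1 + e) * ((1 + e) * (c + e) + (e + e ^+ 2)) + (e + e ^+ 2).
  apply/ler_addgt0Pr => z z0.
  (* For [e <= 1] the error in [main] is at most [e * K]: the terms with [c] contribute [3 * |c|],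
     the others [2 + 5 + 3]. *)
  pose K := 3 * `|c| + 10; have K0 : 0 < K by rewrite /K; have := normr_ge0 c; lra.
  pose e := Num.min 1 (z / K).
  have e0 : 0 < e by rewrite lt_min ltr01 divr_gt0.
  have e1 : e <= 1 by rewrite ge_min lexx.
  have ez : e * K <= z by rewrite -ler_pdivlMr// ge_min lexx orbT.
  apply: (le_trans (main e e0)).
  have cc := ler_norm c; have c0 := normr_ge0 c.
  rewrite /K in ez; move: (`|c|) cc c0 ez => d cd d0 ez.
  have e2 : e ^+ 2 <= e by rewrite expr2 ler_piMr// ltW.
  have e2c : e ^+ 2 * c <= e * d.
    apply: (@le_trans _ _ (e ^+ 2 * d)); first by rewrite ler_wpM2l// sqr_ge0.
    by rewrite ler_wpM2r.
  have e3 : e ^+ 3 <= e by rewrite exprS ler_piMr ?(le_trans e2)// ltW.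
  have ec : e * c <= e * d by rewrite ler_wpM2l// ltW.
  rewrite (_ : (1 + e) * ((1 + e) * (c + e) + (e + e ^+ 2)) + (e + e ^+ 2) =
    c + 2 * (e * c) + e ^+ 2 * c + 2 * e ^+ 3 + 5 * e ^+ 2 + 3 * e); last by ring.
  lra.
move=> e0.
(* Two steps of squared length at most [dl] compose to one of squared length at most [4 * dl]. *)
pose dl := e ^+ 2 / 4; have dl0 : 0 < dl by rewrite divr_gt0// exprn_gt0.
have /choice[g gP] (b : 'cV[R]_p) := rat_approx b dl0.
pose B' : seq 'cV[R]_p := map (map_mx ratr) (map g B).
have e1 : 0 < 1 + e by rewrite addr_gt0.
have tri (a b c' : 'cV[R]_p) : enorm (a - b) ^+ 2 <= dl -> enorm (c' - b) ^+ 2 <= dl ->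
    enorm (a - c') ^+ 2 <= e ^+ 2.
  move=> ab cb; have := sqr_enormD_le (a - b) (b - c') ltr01.
  rewrite addrA subrK -(enormN (b - c')) opprB invr1 => /le_trans; apply.
  by move: ab cb; rewrite /dl; lra.
have BB' : I r B <= (1 + e) * I r B' + (e + e ^+ 2).
  rewrite -lerBlDr -ler_pdivrMl// mulrC.
  apply: I_near => // a /mapP[_ /mapP[b bB ->] ->].
  exists b => //; apply: (le_trans (gP b)); rewrite /dl; have := sqr_ge0 e; lra.
apply: (le_trans BB'); rewrite lerD2r ler_pM2l//.
have meanU : n%:R^-1 * \sum_(i < n) trunc_sqdist r%:R B' (v i) @[n --> U] --> I r B'.
  by move=> N /(@mean_trunc_cvg r (map g B)) ?; exact: Uoo.
apply: (cvgr_to_le meanU).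
have near_or_far : \forall n \near U, forall a, a \in (X n : seq _) ->
    (exists2 b, b \in B' & enorm (a - b) ^+ 2 <= e ^+ 2) \/
    2 * r%:R ^+ 2 + 2 * r%:R <= enorm a ^+ 2.
  have : \forall n \near U, forall j, (exists2 b, b \in B' &
      enorm (tnth (X n) j - b) ^+ 2 <= e ^+ 2) \/
      2 * r%:R ^+ 2 + 2 * r%:R <= enorm (tnth (X n) j) ^+ 2.
    apply: filter_forall => j; have := XL j; case Lj : (L j) => [b|] XLj; last first.
      by apply: filterS (XLj (2 * r%:R ^+ 2 + 2 * r%:R)) => n; right.
    apply: filterS (XLj _ dl0) => n Xb; left; exists (map_mx ratr (g b)).
      by apply/map_f/map_f; rewrite mem_pmap -Lj map_f// mem_enum.
    exact: tri Xb (gP b).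
  by apply: filterS => n h a /tnthP[j ->].
have n1 : \forall n \near U, (0 < n)%N by apply: Uoo; exists 1%N.
near=> n.
have n0 : 0 < n%:R :> R by rewrite ltr0n; near: n.
have nof : forall a, a \in (X n : seq _) ->
    (exists2 b, b \in B' & enorm (a - b) ^+ 2 <= e ^+ 2) \/
    2 * r%:R ^+ 2 + 2 * r%:R <= enorm a ^+ 2 by near: n.
have Xn : (emp_risk n (X n) <= (c + e)%:E)%E by near: n; exact: Xc.
have : ((n%:R^-1 * \sum_(i < n)
    ((trunc_sqdist r%:R B' (v i) - (e + e ^+ 2)) / (1 + e)))%:E <= (c + e)%:E)%E.
  apply: le_trans Xn; rewrite EFinM -sumEFin; apply: lee_wpmul2l.
    by rewrite lee_fin invr_ge0 ltW.
  by apply: lee_sum => i _; exact: trunc_sqdist_perturb.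
rewrite lee_fin -mulr_suml sumrB sumr_const card_ord -(mulr_natl (e + e ^+ 2)).
rewrite mulrA mulrBr mulKf ?gt_eqF// ler_pdivrMr// lerBlDr (mulrC (c + e)).
exact.
Unshelve. all: by end_near. Qed.

End empirical_limit.
(** A proper filter is the intersection of the ultrafilters that contain it: if [A] is not in [F],
    the restriction of [F] to the complement of [A] is proper and extends to an ultrafilter avoiding
    [A]. *)
Lemma near_ultra (T : Type) (F : set_system T) (A : set T) : ProperFilter F ->
  (forall U, UltraFilter U -> F `<=` U -> U A) -> F A.
Proof.
move=> FF FUA; apply: contrapT => NFA.
have WP : ProperFilter (within (~` A) F).
  apply: Build_ProperFilter.
  rewrite /within/= => NA; apply: NFA; near=> t.
  have At : (~` A) t -> False by near: t.
  by apply: contrapT.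
have [U [UU WU]] := ultraFilterLemma WP.
have FU : F `<=` U by move=> B FB; apply: WU; apply: filterS FB.
have UnA : U (~` A) by apply: WU; apply: nearW.
have U0 : U set0 by rewrite -(setICr A); apply: filterI UnA; exact: FUA.
by have [] := filter_ex U0.
Unshelve. all: by end_near. Qed.

(** * Risk and truncated risk under a probability law *)

Section truncated_risk.
Context d (T : measurableType d) (R : realType) (Q : probability T R).
Context (p : nat) (V : T -> 'cV[R]_p).
Hypothesis mV : forall i, measurable_fun [set: T] (fun t => V t i 0).

Definition risk (s : seq 'cV[R]_p) : \bar R := (\int[Q]_t min_sqdist s (V t))%E.

Lemma measurable_sqr_enormB (a : 'cV[R]_p) :
  measurable_fun [set: T] (fun t => enorm (V t - a) ^+ 2).
Proof.
under eq_fun do rewrite sqr_enorm.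
apply: measurable_sum => i; apply: measurable_funX.
under eq_fun do rewrite !mxE.
exact: measurable_funB.
Qed.

Lemma measurable_enorm : measurable_fun [set: T] (fun t => enorm (V t)).
Proof.
rewrite /enorm; apply: measurableT_comp.
  by apply: continuous_measurable_fun; exact: sqrt_continuous.
by apply: measurable_sum => i; exact: measurable_funX.
Qed.

Lemma measurable_min_sqdist (s : seq 'cV[R]_p) :
  measurable_fun [set: T] (fun t => min_sqdist s (V t)).
Proof.
rewrite /min_sqdist; elim: s => [|a s IH].
  by under eq_fun do rewrite big_nil; exact: measurable_cst.
under eq_fun do rewrite big_cons.
by apply: measurable_mine => //; apply/measurable_EFinP; exact: measurable_sqr_enormB.
Qed.

Lemma measurable_trunc_sqdist (r : R) (s : seq 'cV[R]_p) : 0 <= r ->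
  measurable_fun [set: T] (fun t => trunc_sqdist r s (V t)).
Proof.
move=> r0; apply/measurable_EFinP; rewrite /comp.
under eq_fun do rewrite trunc_sqdistE//.
apply: measurable_fun_ifT => //.
  by apply: measurable_fun_ler => //; exact: measurable_enorm.
by apply: measurable_mine => //; exact: measurable_min_sqdist.
Qed.

Lemma risk_nil : risk [::] = +oo%E.
Proof.
transitivity (\int[Q]_t (cst +oo t))%E.
  by apply: eq_integral => t _; exact: min_sqdist_nil.
by rewrite integral_cst// [X in (_ * X)%E]probability_setT mule1.
Qed.

Lemma risk_ge0 s : (0 <= risk s)%E.
Proof. by apply: integral_ge0 => t _; exact: min_sqdist_ge0. Qed.

Lemma risk_sub s s' : {subset s <= s'} -> (risk s' <= risk s)%E.
Proof.
move=> ss'; apply: ge0_le_integral => //.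
- by move=> t _; exact: min_sqdist_ge0.
- exact: measurable_min_sqdist.
- exact: measurable_min_sqdist.
- by move=> t _; exact: min_sqdist_sub.
Qed.

Definition trunc_risk (r : nat) s : R :=
  fine (\int[Q]_t (trunc_sqdist r%:R s (V t))%:E)%E.

Lemma trunc_riskE (r : nat) s :
  (\int[Q]_t (trunc_sqdist r%:R s (V t))%:E = (trunc_risk r s)%:E)%E.
Proof.
rewrite /trunc_risk fineK// ge0_fin_numE; last first.
  by apply: integral_ge0 => t _; rewrite lee_fin trunc_sqdist_ge0.
apply: (@le_lt_trans _ _ (\int[Q]_t (cst r%:R%:E t))%E).
  apply: ge0_le_integral => //.
  - by move=> t _; rewrite lee_fin trunc_sqdist_ge0.
  - exact/measurable_EFinP/measurable_trunc_sqdist.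
  - by move=> t _; rewrite lee_fin trunc_sqdist_le.
by rewrite integral_cst// [X in (_ * X)%E]probability_setT mule1 ltry.
Qed.

Lemma trunc_risk_near (e : R) (r : nat) s s' : 0 < e ->
  (forall a, a \in s' -> exists2 b, b \in s & enorm (a - b) ^+ 2 <= e ^+ 2) ->
  (trunc_risk r s - (e + e ^+ 2)) / (1 + e) <= trunc_risk r s'.
Proof.
move=> e0 near_s; have e1 : 0 < 1 + e by rewrite addr_gt0.
have ce0 : 0 <= e + e ^+ 2 by rewrite addr_ge0 ?sqr_ge0// ltW.
rewrite ler_pdivrMr// lerBlDr mulrC -lee_fin EFinD EFinM -!trunc_riskE.
rewrite -ge0_integralZl_EFin//; first last.
- exact: ltW.
- exact/measurable_EFinP/measurable_trunc_sqdist.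
- by move=> t _; rewrite lee_fin trunc_sqdist_ge0.
have -> : ((e + e ^+ 2)%:E = \int[Q]_t (cst (e + e ^+ 2)%:E t))%E.
  by rewrite integral_cst// [X in (_ * X)%E]probability_setT mule1.
rewrite -ge0_integralD//; first last.
- by apply: measurable_funeM; exact/measurable_EFinP/measurable_trunc_sqdist.
- by move=> t _; rewrite -EFinM lee_fin mulr_ge0 ?trunc_sqdist_ge0// ltW.
apply: ge0_le_integral => //.
- by move=> t _; rewrite lee_fin trunc_sqdist_ge0.
- exact/measurable_EFinP/measurable_trunc_sqdist.
- apply: emeasurable_funD => //; apply: measurable_funeM.
  exact/measurable_EFinP/measurable_trunc_sqdist.
- move=> t _; rewrite /= -EFinM -EFinD lee_fin -lerBlDr mulrC -ler_pdivrMr//.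
  exact: trunc_sqdist_near.
Qed.

Lemma trunc_sqdist_cvg s (x : 'cV[R]_p) :
  (trunc_sqdist r%:R s x)%:E @[r --> \oo] --> min_sqdist s x.
Proof.
have xr : \forall r \near \oo, enorm x <= r%:R.
  exists (Num.truncn (enorm x)).+1 => // n /= xn.
  by rewrite (le_trans (ltW (truncnS_gt _)))// ler_nat.
have eqmin : \forall r \near \oo,
    mine (min_sqdist s x) r%:R%:E = (trunc_sqdist r%:R s x)%:E.
  by apply: filterS xr => r xr; rewrite trunc_sqdistE// xr.
apply: cvg_trans (near_eq_cvg eqmin) _.
have := min_sqdist_ge0 s x; case: (min_sqdist s x) => [y| |]// _.
  apply: cvg_near_cst; exists (Num.truncn y).+1 => // n /= yn.
  apply/min_idPl; rewrite lee_fin.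
  by rewrite (le_trans (ltW (truncnS_gt _)))// ler_nat.
(* The remaining value [+oo] arises for empty [s]; the minima are then [r] itself. *)
rewrite (_ : (fun r => _) = fun r : nat => (r%:R : R)%:E); last first.
  by apply/funext => r; rewrite min_r// leey.
by apply/cvgeryP; exact: cvgr_idn.
Qed.

(** Monotone convergence: the truncations increase with [r] to the untruncated minimum. *)
Lemma risk_le s (c : R) : (forall r, trunc_risk r s <= c) -> (risk s <= c%:E)%E.
Proof.
move=> sc; rewrite /risk.
rewrite (_ : (fun t => min_sqdist s (V t)) =
    fun t => limn (fun r => (trunc_sqdist r%:R s (V t))%:E)); last first.
  by apply/funext => t; apply/esym/cvg_lim => //; exact: trunc_sqdist_cvg.
have mts r : measurable_fun [set: T] (fun t => (trunc_sqdist r%:R s (V t))%:E).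
  exact/measurable_EFinP/measurable_trunc_sqdist.
have ts0 (r : nat) t : [set: T] t -> (0 <= (trunc_sqdist r%:R s (V t))%:E)%E.
  by move=> _; rewrite lee_fin trunc_sqdist_ge0.
have ts_nd t : [set: T] t ->
    {homo (fun r : nat => (trunc_sqdist r%:R s (V t))%:E) :
      i j / (i <= j)%N >-> (i <= j)%E}.
  move=> _ i j ij; have ijR : i%:R <= j%:R :> R by rewrite ler_nat.
  rewrite !trunc_sqdistE//; case: ifP => [/le_trans/(_ ijR) ->|_].
    by rewrite le_min2 ?lee_fin.
  by case: ifP => // _; rewrite le_min min_sqdist_ge0 lee_fin ler0n.
rewrite monotone_convergence//; apply: lime_le.
  apply: ereal_nondecreasing_is_cvgn => i j ij; apply: ge0_le_integral => //.
  - by move=> t _; exact: ts0.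
  - by move=> t _; exact: ts_nd.
by apply: nearW => r; rewrite trunc_riskE lee_fin.
Qed.

End truncated_risk.
(** * Consistency *)

Section hausdorff_distance.
Context (R : realType) (p : nat).
Implicit Types (A B : {fset 'cV[R]_p}).

Lemma bigmaxe_le (I : eqType) (s : seq I) (F : I -> \bar R) (y : \bar R) :
  (\big[maxe/-oo]_(a <- s) F a <= y)%E = all (fun a => (F a <= y)%E) s.
Proof.
elim: s => [|a s IH]; first by rewrite big_nil leNye.
by rewrite big_cons ge_max IH.
Qed.

Lemma bigmine_le (I : eqType) (s : seq I) (F : I -> \bar R) (b : I) :
  b \in s -> (\big[mine/+oo]_(a <- s) F a <= F b)%E.
Proof.
elim: s => // a s IH; rewrite inE big_cons ge_min => /predU1P[->|/IH ->].
  by rewrite lexx.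
by rewrite orbT.
Qed.

Lemma bigmine_ge0 (I : eqType) (s : seq I) (F : I -> R) :
  (forall a, 0 <= F a) -> (0 <= \big[mine/+oo]_(a <- s) (F a)%:E)%E.
Proof.
move=> F0; elim: s => [|a s IH]; first by rewrite big_nil leey.
by rewrite big_cons le_min IH lee_fin F0.
Qed.

(** A point of [A] keeps the first maximum away from its default [-oo]. *)
Lemma hausdorff_dist_ge0 A B : A != fset0 -> (0 <= hausdorff_dist A B)%E.
Proof.
case/fset0Pn => a aA; rewrite /hausdorff_dist le_max; apply/orP; left.
have := lexx (\big[maxe/-oo%E]_(a <- A) \big[mine/+oo%E]_(b <- B) (enorm (a - b))%:E)%E.
rewrite bigmaxe_le => /allP/(_ a aA); apply: le_trans.
by apply: bigmine_ge0 => b; exact: enorm_ge0.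
Qed.

Lemma hausdorff_dist_le A B (e : R) :
  (forall a, a \in A -> exists2 b, b \in B & enorm (a - b) <= e) ->
  (forall b, b \in B -> exists2 a, a \in A & enorm (a - b) <= e) ->
  (hausdorff_dist A B <= e%:E)%E.
Proof.
move=> AB BA; rewrite /hausdorff_dist ge_max !bigmaxe_le; apply/andP; split.
  apply/allP => a /AB[b bB ab].
  by apply: le_trans (bigmine_le (fun b => (enorm (a - b))%:E) bB) _; rewrite lee_fin.
apply/allP => b /BA[a aA ab].
by apply: le_trans (bigmine_le (fun a => (enorm (a - b))%:E) aA) _; rewrite lee_fin.
Qed.

End hausdorff_distance.

Lemma mutually_independentW d d' (Omega : measurableType d)
    (T : measurableType d') (R : realType) (P : probability Omega R)
    (S : nat -> {RV P >-> T}) :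
  mutually_independent S -> pairwise_independent S.
Proof.
move=> S_indep i j ij A B mA mB.
have := S_indep [fset i; j]%fset (fun n => if n == i then A else B) _.
rewrite big_fsetU1 ?inE//= big_seq_fset1 eqxx eq_sym (negbTE ij).
move=> <-; last by move=> n _; case: ifP.
congr (P _); apply/seteqP; split => [w [Aw Bw] n /=|w ABw].
  by rewrite !inE => /orP[] /eqP ->; rewrite ?eqxx// eq_sym (negbTE ij).
split.
  by have := ABw i; rewrite /= !inE eqxx; exact.
by have := ABw j; rewrite /= !inE eqxx orbT eq_sym (negbTE ij); exact.
Qed.

(** * Consistency along one sample path *)

Section sample_path.
Context d (T : measurableType d) (R : realType) (Q : probability T R).
Context (p : nat) (V : T -> 'cV[R]_p).
Hypothesis mV : forall i, measurable_fun [set: T] (fun t => V t i 0).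

Lemma risk_lty s (a : 'cV[R]_p) : a \in s ->
  (\int[Q]_t (enorm (V t) ^+ 2)%:E < +oo)%E -> (risk Q V s < +oo)%E.
Proof.
move=> sa V2; have mV2 : measurable_fun [set: T] (fun t => (enorm (V t) ^+ 2)%:E).
  by apply/measurable_EFinP; apply: measurable_funX; exact: measurable_enorm.
have V20 t : (0 <= (enorm (V t) ^+ 2)%:E)%E by rewrite lee_fin sqr_ge0.
pose c := 2 * enorm a ^+ 2.
have c0 : (0 <= c%:E)%E by rewrite lee_fin mulr_ge0 ?sqr_ge0.
apply: (@le_lt_trans _ _ (\int[Q]_t (2%:E * (enorm (V t) ^+ 2)%:E + cst c%:E t))%E).
  apply: ge0_le_integral => //.
  - by move=> t _; exact: min_sqdist_ge0.
  - exact: measurable_min_sqdist.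
  - by apply: emeasurable_funD => //; exact: measurable_funeM.
  move=> t _; apply: (le_trans (min_sqdist_le _ sa)).
  have := sqr_enormD_le (V t) (- a) ltr01; rewrite enormN invr1.
  by rewrite -EFinM -EFinD lee_fin.
rewrite ge0_integralD//; first last.
- exact: measurable_funeM.
- by move=> t _; rewrite mule_ge0.
rewrite ge0_integralZl_EFin// integral_cst// [X in (c%:E * X)%E]probability_setT mule1.
by rewrite lte_add_pinfty ?ltry// lte_mul_pinfty.
Qed.

Context (k : nat) (v : nat -> 'cV[R]_p) (X : nat -> k.-tuple 'cV[R]_p).
Hypothesis mean_trunc_cvg : forall (r : nat) (q : seq 'cV[rat]_p),
  n%:R^-1 * \sum_(i < n) trunc_sqdist r%:R (map (map_mx ratr) q) (v i)
    @[n --> \oo] --> trunc_risk Q V r (map (map_mx ratr) q).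

(** The level [c] is left free: it is [c0] when the centers are located, and a hypothetical smaller
    value when the objective is bounded from below. *)
Lemma ultra_limit_centers (U : set_system nat) (c : R) :
  UltraFilter U -> U --> \oo ->
  (forall e, 0 < e -> \forall n \near U, (emp_risk v n (X n) <= (c + e)%:E)%E) ->
  exists2 L : 'I_k -> option 'cV[R]_p,
    forall j, tends_to U (fun n => tnth (X n) j) (L j) &
    (risk Q V (pmap L (enum 'I_k)) <= c%:E)%E.
Proof.
move=> UU Uoo Xc.
have /choice[L LP] (j : 'I_k) := ultra_tends_to (fun n => tnth (X n) j) UU.
exists L => //; apply: risk_le => // r.
have near_risk := fun e r s s' => @trunc_risk_near _ _ _ Q _ _ mV e r s s'.
exact: (@trunc_risk_le_emp_risk _ _ _ _ _ mean_trunc_cvg near_risk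
  _ _ _ _ r (@ultra_proper _ _ UU) Uoo LP Xc).
Qed.

Context (A : {fset 'cV[R]_p}) (c0 : R).
Hypothesis card_A : #|` A| = k.
Hypothesis k_gt0 : (0 < k)%N.
Hypothesis A_min : forall B : {fset 'cV[R]_p}, (1 <= #|` B| <= k)%N ->
  (c0%:E <= risk Q V B)%E.
Hypothesis A_unique : forall B : {fset 'cV[R]_p}, (1 <= #|` B| <= k)%N ->
  risk Q V B = c0%:E -> A = B.
Hypothesis mean_A_cvg : n%:R^-1 * \sum_(i < n) fine (min_sqdist A (v i))
  @[n --> \oo] --> c0.
Hypothesis X_min : forall n, (1 <= n)%N -> forall Y : k.-tuple 'cV[R]_p,
  (emp_risk v n (X n) <= emp_risk v n Y)%E.

Let emp_risk_ge0 n (s : seq 'cV[R]_p) : (0 <= emp_risk v n s)%E.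
Proof.
rewrite mule_ge0// ?lee_fin ?invr_ge0//.
by apply: sume_ge0 => i _; exact: min_sqdist_ge0.
Qed.

Let emp_risk_le e : 0 < e -> \forall n \near \oo, (emp_risk v n (X n) <= (c0 + e)%:E)%E.
Proof.
(* As [A] has exactly [k] points, it is itself a competitor of [X n]. *)
move=> e0; pose Y : k.-tuple 'cV[R]_p := Tuple (introT eqP card_A).
have [a aA] : exists a, a \in A by apply/fset0Pn; rewrite -cardfs_gt0 card_A.
move/cvgrPdist_le : mean_A_cvg => /(_ e e0) Ae.
near=> n; apply: (@le_trans _ _ (emp_risk v n Y)).
  by apply: X_min; near: n; exists 1%N.
rewrite /emp_risk.
under eq_bigr do rewrite -(fineK (min_sqdist_fin_num _ (aA : a \in (Y : seq _)))).
rewrite sumEFin -EFinM lee_fin.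
have : `|c0 - n%:R^-1 * \sum_(i < n) fine (min_sqdist A (v i))| <= e by near: n.
by rewrite distrC ler_distl => /andP[_].
Unshelve. all: by end_near. Qed.

Let center_set (L : 'I_k -> option 'cV[R]_p) : {fset 'cV[R]_p} :=
  [fset b in pmap L (enum 'I_k)]%fset.

Let risk_center_set L : risk Q V (center_set L) = risk Q V (pmap L (enum 'I_k)).
Proof.
by apply/eqP; rewrite eq_le !risk_sub// => b; rewrite !inE.
Qed.

(** The empty set has risk [+oo], so a finite risk prevents all centers from escaping. *)
Let card_center_set L (c : R) : (risk Q V (pmap L (enum 'I_k)) <= c%:E)%E ->
  (1 <= #|` center_set L| <= k)%N.
Proof.
move=> riskc; apply/andP; split.
  rewrite cardfs_gt0; apply/negP => /eqP L0.
  move: riskc; rewrite -risk_center_set L0 (_ : risk Q V fset0 = +oo)%E ?leye_eq//.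
  by rewrite -(risk_nil Q V); congr risk.
rewrite card_fseq (leq_trans (size_undup _))// size_pmap (leq_trans (count_size _ _))//.
by rewrite size_enum_ord.
Qed.

Let ultra_risk_ge (U : set_system nat) (c : R) : UltraFilter U -> U --> \oo ->
  (forall e, 0 < e -> \forall n \near U, (emp_risk v n (X n) <= (c + e)%:E)%E) ->
  c0 <= c.
Proof.
move=> UU Uoo Xc; have [L _ Lc] := ultra_limit_centers UU Uoo Xc.
rewrite -lee_fin; apply: le_trans (Lc); rewrite -risk_center_set.
by apply: A_min; exact: card_center_set Lc.
Qed.

Let ultra_centers_cvg (U : set_system nat) : UltraFilter U -> U --> \oo ->
  exists f : 'I_k -> 'cV[R]_p, [/\ forall j, f j \in A,
    forall a, a \in A -> exists j, a = f j &
    forall e, 0 < e -> \forall n \near U, forall j, enorm (tnth (X n) j - f j) <= e].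
Proof.
move=> UU Uoo.
have Xc0 e : 0 < e -> \forall n \near U, (emp_risk v n (X n) <= (c0 + e)%:E)%E.
  by move=> e0; apply: Uoo; exact: emp_risk_le.
have [L LP Lc0] := ultra_limit_centers UU Uoo Xc0.
have cL := card_center_set Lc0.
have AL : A = center_set L.
  apply: A_unique => //; apply/eqP; rewrite eq_le A_min// andbT.
  by rewrite risk_center_set.
(* The [k] points of [A] are all among the finite limits of the [k] centers, so no center has limit
   [None]. *)
have allL : all (fun j => isSome (L j)) (enum 'I_k).
  rewrite all_count size_enum_ord eqn_leq -[leqRHS]size_enum_ord count_size/=.
  by rewrite -[leqLHS]card_A AL card_fseq -size_pmap size_undup.
have /choice[f fP] (j : 'I_k) : exists b, L j = Some b.
  by have /allP/(_ j) := allL; rewrite mem_enum => /(_ isT);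
    case: (L j) => // b _; exists b.
exists f; split.
- by move=> j; rewrite AL !inE mem_pmap -fP map_f// mem_enum.
- move=> a; rewrite AL !inE mem_pmap => /mapP[j _ aj]; exists j.
  by move: aj; rewrite fP => -[].
- move=> e e0; apply: filter_forall => j; have := LP j; rewrite /tends_to fP.
  move=> /(_ (e ^+ 2)); rewrite exprn_gt0// => /(_ isT); apply: filterS => n.
  by rewrite ler_sqr// nnegrE ?enorm_ge0// ltW.
Qed.

(** The upper bound comes from comparison with [A]. If the lower bound failed along an ultrafilter,
    [c0 - e] would bound the empirical risks there, against the minimality of [A]. *)
Lemma emp_risk_cvg : emp_risk v n (X n) @[n --> \oo] --> c0%:E.
Proof.
have Xfin : \forall n \near \oo, emp_risk v n (X n) \is a fin_num.
  apply: filterS (emp_risk_le ltr01) => n Xn.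
  by rewrite ge0_fin_numE//; exact: le_lt_trans Xn (ltry _).
apply: cvg_EFin => //; apply/cvgrPdist_le => e e0.
have hi := emp_risk_le e0.
have lo : \forall n \near \oo, ((c0 - e)%:E <= emp_risk v n (X n))%E.
  apply: near_ultra => U UU Uoo.
  have [//|Ulo] := in_ultra_setVsetC [set n | ((c0 - e)%:E <= emp_risk v n (X n))%E] UU.
  suff : c0 <= c0 - e by move: e0; lra.
  apply: (ultra_risk_ge UU) => // z z0; apply: filterS Ulo => n /= /negP.
  rewrite -ltNge => /ltW/le_trans; apply; by rewrite lee_fin lerDl ltW.
near=> n; rewrite distrC ler_distl -!lee_fin /= fineK; last by near: n.
by apply/andP; split; near: n.
Unshelve. all: by end_near. Qed.

(** The pairing [f] of centers with points of [A] depends on the ultrafilter, as the labels in [X n]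
    may be permuted with [n]. The Hausdorff distance ignores labels, so the same bound holds along
    every ultrafilter. *)
Lemma hausdorff_centers_cvg :
  hausdorff_dist [fset tnth (X n) j | j : 'I_k]%fset A @[n --> \oo] --> 0%E.
Proof.
have Xn0 n : [fset tnth (X n) j | j : 'I_k]%fset != fset0.
  apply/fset0Pn; exists (tnth (X n) (Ordinal k_gt0)).
  by apply/imfsetP; exists (Ordinal k_gt0).
have small e : 0 < e -> \forall n \near \oo,
    (hausdorff_dist [fset tnth (X n) j | j : 'I_k]%fset A <= e%:E)%E.
  move=> e0; apply: near_ultra => U UU Uoo.
  have [f [fA Af /(_ e e0)]] := ultra_centers_cvg UU Uoo.
  apply: filterS => n Xf; apply: hausdorff_dist_le.
    by move=> _ /imfsetP[j _ ->]; exists (f j).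
  move=> b /Af[j ->]; exists (tnth (X n) j) => //.
  by apply/imfsetP; exists j.
apply: cvg_EFin.
  apply: filterS (small 1 ltr01) => n Xn.
  rewrite ge0_fin_numE; last exact: hausdorff_dist_ge0.
  exact: le_lt_trans Xn (ltry _).
apply/cvgrPdist_le => e e0; apply: filterS (small e e0) => n Xn.
have hX := hausdorff_dist_ge0 A (Xn0 n).
rewrite sub0r normrN /= ger0_norm ?fine_ge0// -lee_fin fineK//.
by rewrite ge0_fin_numE//; exact: le_lt_trans Xn (ltry _).
Qed.

End sample_path.

(** * Size of the optimal set, and passage to almost every sample path *)

(** An extra point never increases the risk, so below [k] points any new point would give a second
    optimal set. *)
Lemma card_unique_optimal (R : realType) (m k : nat)
    (ord : 'I_(m * m.-1)./2 -> 'I_m * 'I_m) (PS : probability (spdB R m) R)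
    (A : {fset 'cV[R]_(cdim m)}) : (0 < m)%N ->
  unique (is_optimal ord k PS) A -> #|` A| = k.
Proof.
move=> m0 [[/andP[A1 Ak] QA] Auniq]; apply/eqP; rewrite eqn_leq Ak leqNgt/=.
apply/negP => Altk.
have p0 : (0 < cdim m)%N by rewrite /cdim addn_gt0 m0 orbT.
pose i0 := Ordinal p0.
(* A new point: its first coordinate, which exists because [m] is positive, exceeds that of every
   point of [A]. *)
pose x : 'cV[R]_(cdim m) := const_mx (1 + \sum_(a <- A) `|a i0 0|).
have xA : x \notin A.
  apply/negP => xA; have : x i0 0 <= \sum_(a <- A) `|a i0 0|.
    by rewrite (big_fsetD1 x)//= (le_trans (ler_norm _))// lerDl sumr_ge0.
  by rewrite mxE; lra.
have mV := @measurable_chol_coord R m ord.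
suff /Auniq Ax : is_optimal ord k PS (x |` A)%fset.
  by move: xA; rewrite Ax fset1U1.
have card_xA : (1 <= #|` (x |` A)%fset| <= k)%N by rewrite cardfsU1 xA add1n.
split=> //; apply/eqP; rewrite eq_le; apply/andP; split.
  rewrite -QA; apply: (risk_sub PS mV) => b bA.
  by rewrite in_fsetE/= bA orbT.
by apply: ereal_inf_lbound; exists (x |` A)%fset.
Qed.

Theorem proposition1 (R : realType) (m k : nat)
    (m_ge1 : (1 <= m)%N) (k_ge1 : (1 <= k)%N)
    (ord : 'I_(m * m.-1)./2 -> 'I_m * 'I_m) (ord_lower : lower_enum ord)
    (d : measure_display) (Omega : measurableType d) (P : probability Omega R)
    (PS : probability (spdB R m) R)
    (S : nat -> {RV P >-> spdB R m})
    (S_indep : mutually_independent S)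
    (S_law : forall i, has_law (S i) PS)
    (moment2 : (\int[PS]_s (enorm (chol_coord ord s) ^+ 2)%:E < +oo)%E)
    (A : nat -> {fset 'cV[R]_(cdim m)})
    (A_unique : forall j, (1 <= j <= k)%N -> unique (is_optimal ord j PS) (A j))
    (X : nat -> Omega -> k.-tuple 'cV[R]_(cdim m))
    (X_min : forall (n : nat) (w : Omega), (1 <= n)%N ->
       forall Y : k.-tuple 'cV[R]_(cdim m),
         (kmeans_obj ord (fun i => S i w) n (X n w) <=
          kmeans_obj ord (fun i => S i w) n Y)%E) :
  {ae P, forall w,
    (hausdorff_dist [fset tnth (X n w) j | j : 'I_k]%fset (A k) @[n --> \oo] --> 0%E) /\
    (kmeans_obj ord (fun i => S i w) n (X n w) @[n --> \oo] -->
      min_risk ord k PS)}.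
Proof.
have mV := @measurable_chol_coord R m ord.
have A_opt := A_unique k; rewrite k_ge1 leqnn in A_opt.
have {A_opt} A_opt := A_opt isT.
have card_A := card_unique_optimal m_ge1 A_opt.
have [[_ QA] Auniq] := A_opt.
pose V := @chol_coord R m ord.
have S_pair := mutually_independentW S_indep.
have [a aA] : exists a, a \in A k by apply/fset0Pn; rewrite -cardfs_gt0 card_A.
have [c0 riskA] : exists c0, risk PS V (A k) = c0%:E.
  exists (fine (risk PS V (A k))); rewrite fineK// ge0_fin_numE ?risk_ge0//.
  exact: risk_lty aA moment2.
have min_c0 : min_risk ord k PS = c0%:E by rewrite -QA.
have A_min (B : {fset 'cV[R]_(cdim m)}) : (1 <= #|` B| <= k)%N ->
    (c0%:E <= risk PS V B)%E.
  by move=> cB; rewrite -min_c0; apply: ereal_inf_lbound; exists B.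
have A_uniq (B : {fset 'cV[R]_(cdim m)}) : (1 <= #|` B| <= k)%N ->
    risk PS V B = c0%:E -> A k = B.
  by move=> cB riskB; apply: Auniq; split=> //; rewrite min_c0.
have mean_A : {ae P, forall w,
    n%:R^-1 * \sum_(i < n) fine (min_sqdist (A k) (V (S i w))) @[n --> \oo] --> c0}.
  pose f (s : spdB R m) := fine (min_sqdist (A k) (V s)).
  have mf : measurable_fun [set: spdB R m] f.
    by apply: measurableT_comp => //; exact: measurable_min_sqdist.
  have f0 s : 0 <= f s by rewrite fine_ge0// min_sqdist_ge0.
  apply: (strong_law S_law S_pair mf f0); rewrite -riskA; apply: eq_integral => s _.
  by rewrite fineK// (min_sqdist_fin_num _ aA).
have mean_trunc (r : nat) (q : seq 'cV[rat]_(cdim m)) : {ae P, forall w,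
    n%:R^-1 * \sum_(i < n) trunc_sqdist r%:R (map (map_mx ratr) q) (V (S i w))
      @[n --> \oo] --> trunc_risk PS V r (map (map_mx ratr) q)}.
  pose f (s : spdB R m) := trunc_sqdist r%:R (map (map_mx ratr) q) (V s).
  have mf : measurable_fun [set: spdB R m] f by exact: measurable_trunc_sqdist.
  have f0 s : 0 <= f s by exact: trunc_sqdist_ge0.
  exact: (strong_law S_law S_pair mf f0 (trunc_riskE PS mV r _)).
have mean_trunc_all : {ae P, forall w (rq : nat * seq 'cV[rat]_(cdim m)),
    n%:R^-1 * \sum_(i < n) trunc_sqdist rq.1%:R (map (map_mx ratr) rq.2) (V (S i w))
      @[n --> \oo] --> trunc_risk PS V rq.1 (map (map_mx ratr) rq.2)}.
  (* Pairs are enumerated by their codes, so one null set serves all of them; an integer that codes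
     no pair gets a dummy pair. *)
  pose code c := odflt (0%N, [::])
    (@choice.unpickle (nat * seq 'cV[rat]_(cdim m))%type c).
  have := ae_foralln (fun c => mean_trunc (code c).1 (code c).2).
  by apply: filterS => w mean_w rq; have := mean_w (choice.pickle rq);
     rewrite /code choice.pickleK.
apply: filterS2 mean_A mean_trunc_all => w mean_A_w mean_trunc_w.
have mean_w r q := mean_trunc_w (r, q).
pose v i := V (S i w).
have Xw_min n : (1 <= n)%N -> forall Y : k.-tuple 'cV[R]_(cdim m),
    (emp_risk v n (X n w) <= emp_risk v n Y)%E by exact: X_min.
rewrite min_c0; split.
  exact: (hausdorff_centers_cvg (Q := PS) (v := v) (X := X ^~ w) mV mean_w
    card_A k_ge1 A_min A_uniq mean_A_w Xw_min).
exact: (emp_risk_cvg (Q := PS) (v := v) (X := X ^~ w) mV mean_w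
  card_A k_ge1 A_min mean_A_w Xw_min).
Qed.
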